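(* Let $X$ be a Banach space with a Schauder basis satisfying property $\mathcal{P}$. If $X$ admits $\ell^1$ as a spreading model generated by a weakly relatively compact $\mathcal{F}$-subsequence (for some regular thin family $\mathcal{F}$), then $X$ admits $\ell^1$ as a plegma block generated spreading model.
   Context: Property $\mathcal{P}$ for a Banach space $X$ with a Schauder basis: for every $\delta>0$ there exists $k\in\mathbb{N}$ such that every finite block sequence $(x_i)_{i=1}^k$ in $X$ (finitely supported vectors with $\max\mathrm{supp}(x_i)<\min\mathrm{supp}(x_{i+1})$) with $\|x_i\|\ge\delta$ for all $i$ satisfies $\|\sum_{i=1}^kx_i\|>1$. $\mathbb{N}=\{1,2,\dots\}$. For $M\subseteq\mathbb{N}$ infinite, $M(k)$ is its $k$-th element; for a finite set $s$, $s(k)$ is its $k$-th element; $t\sqsubseteq s$ means initial segment. For a family $\mathcal{F}$ of finite subsets of $\mathbb{N}$ let $\widehat{\mathcal{F}}=\{t:\exists s\in\mathcal{F},\ t\sqsubseteq s\}$ and $\mathcal{F}\upharpoonright M=\{s\in\mathcal{F}:s\subseteq M\}$. $\mathcal{F}$ is thin if no element is a proper initial segment of another. A family is regular if it is hereditary (closed under subsets), spreading (if $\{n_1<\dots<n_k\}$ is in it, $m_1<\dots<m_k$, $n_i\le m_i$ for all $i$, then $\{m_1,\dots,m_k\}$ is in it) and compact (its characteristic functions form a closed subset of $\{0,1\}^{\mathbb{N}}$). $\mathcal{F}$ is regular thin if it is thin and $\widehat{\mathcal{F}}$ is regular; regular thin families are assumed to contain a nonempty set. A tuple $(s_1,\dots,s_l)$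 of nonempty finite subsets of $\mathbb{N}$ is plegma if $s_i(k)<s_j(k)$ whenever $i<j$ and $k\le\min(|s_i|,|s_j|)$, and $s_i(k)<s_j(k+1)$ for all $i,j$ and $k\le\min(|s_i|,|s_j|-1)$. An $\mathcal{F}$-subsequence $(x_s)_{s\in\mathcal{F}\upharpoonright M}$ in $X$ ($M\subseteq\mathbb{N}$ infinite) is a map $s\mapsto x_s$ from $\mathcal{F}\upharpoonright M$ to $X$; it is weakly relatively compact if the weak closure of $\{x_s:s\in\mathcal{F}\upharpoonright M\}$ is weakly compact. Let $(e_n)_n$ be a Hamel basis of an infinite-dimensional seminormed space with seminorm $\|\cdot\|_*$. $(x_s)_{s\in\mathcal{F}\upharpoonright M}$ generates $(e_n)_n$ as an $\mathcal{F}$-spreading model if there is a null sequence $(\delta_n)_n$ of positive reals such that $\big|\,\|\sum_{j=1}^k a_jx_{s_j}\|-\|\sum_{j=1}^k a_je_j\|_*\big|\le\delta_l$ for all $1\le k\le l$, all plegma $k$-tuples $(s_j)_{j=1}^k$ in $\mathcal{F}\upharpoonright M$ with $s_1(1)\ge M(l)$ and all $a_1,\dots,a_k\in[-1,1]$. It generates $\ell^1$ as a spreading model if it generates some $(e_n)_n$ equivalent to the usual basis of $\ell^1$. $(x_s)_{s\in\mathcal{F}\upharpoonright M}$ is plegma block if all $x_s$ are finitely supported and $\mathrm{supp}(x_{s_1})<\mathrm{supp}(x_{s_2})$ for every plegma pair $(s_1,s_2)$ in $\mathcal{F}\upharpoonright M$. $X$ admits $\ell^1$ as a plegma block generated spreading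 model if for some regular thin $\mathcal{F}$ there is a plegma block $\mathcal{F}$-subsequence in $X$ generating $\ell^1$ as an $\mathcal{F}$-spreading model. *)

(* Defs.v *)
From HB Require Import structures.
From mathcomp Require Import all_boot all_order all_algebra finmap.
From mathcomp Require Import all_classical all_reals all_analysis.

Set Implicit Arguments.
Unset Strict Implicit.
Unset Printing Implicit Defensive.

Import Order.TTheory GRing.Theory Num.Theory.
Import numFieldNormedType.Exports.

Local Open Scope classical_set_scope.
Local Open Scope ring_scope.

(* The positive integers are represented by nat through n |-> n - 1, and
   positions in finite sets and in sequences are counted from 0. *)

(* elt s k is the (k+1)-st smallest element of s when k < #|` s|. *)
Definition elt (s : {fset nat}) (k : nat) : nat := nth 0%N (sort leq s) k.

Definition initial_segment (t s : {fset nat}) : bool :=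
  prefix (sort leq t) (sort leq s).

Definition hat (F : set {fset nat}) : set {fset nat} :=
  [set t | exists2 s, F s & initial_segment t s].

Definition thin (F : set {fset nat}) : Prop :=
  forall s t, F s -> F t -> initial_segment t s -> t = s.

Definition hereditary (F : set {fset nat}) : Prop :=
  forall s t : {fset nat}, F s -> (t `<=` s)%fset -> F t.

Definition spreading (F : set {fset nat}) : Prop :=
  forall s t : {fset nat}, F s -> #|` t| = #|` s| ->
    (forall k, (k < #|` s|)%N -> (elt s k <= elt t k)%N) -> F t.

Definition compact_family (F : set {fset nat}) : Prop :=
  closed [set ((fun n => n \in s) : cantor_space) | s in F].

Definition regular_family (F : set {fset nat}) : Prop :=
  [/\ hereditary F, spreading F & compact_family F].

Definition regular_thin (F : set {fset nat}) : Prop :=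
  [/\ thin F, regular_family (hat F) & exists2 s, F s & s != fset0].

(* An infinite subset of N is given by its increasing enumeration M. *)
Definition restrict_family (F : set {fset nat}) (M : nat -> nat) :
    set {fset nat} :=
  [set s | F s /\ [set` s] `<=` range M].

(* In 0-based positions, "k <= |s_i| and k <= |s_j| - 1" for the 1-based k
   reads "k < |s_i| and k + 1 < |s_j|". *)
Definition plegma (ss : seq {fset nat}) : Prop :=
  let s i := nth fset0 ss i in
  [/\ forall i, (i < size ss)%N -> s i != fset0,
      forall i j k, (i < j < size ss)%N ->
        (k < minn #|` s i| #|` s j|)%N -> (elt (s i) k < elt (s j) k)%N
    & forall i j k, (i < size ss)%N -> (j < size ss)%N ->
        (k < minn #|` s i| #|` s j|.-1)%N ->
        (elt (s i) k < elt (s j) k.+1)%N].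

Definition schauder_basis (R : realType) (X : normedModType R)
    (b : nat -> X) : Prop :=
  forall x : X,
    exists! a : nat -> R, series (fun n => a n *: b n) @ \oo --> x.

Definition schauder_coord (R : realType) (X : normedModType R) (b : nat -> X)
    (x : X) : nat -> R :=
  xget (fun=> 0) [set a : nat -> R | series (fun n => a n *: b n) @ \oo --> x].

Definition supp (R : realType) (X : normedModType R) (b : nat -> X) (x : X) :
    set nat :=
  [set n | schauder_coord b x n != 0].

(* A < B, that is max A < min B; it holds vacuously when A or B is empty. *)
Definition set_lt (A B : set nat) : Prop :=
  forall m n, A m -> B n -> (m < n)%N.

Definition property_P (R : realType) (X : normedModType R) (b : nat -> X) :
    Prop :=
  forall delta : R, 0 < delta ->
    exists2 k : nat, (0 < k)%N &
      forall x : nat -> X,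
        (forall i, (i < k)%N -> finite_set (supp b (x i))) ->
        (forall i, (i.+1 < k)%N -> set_lt (supp b (x i)) (supp b (x i.+1))) ->
        (forall i, (i < k)%N -> delta <= `|x i|) ->
        1 < `|\sum_(i < k) x i|.

Definition topological_dual (R : realType) (X : normedModType R) : Type :=
  {f : {linear X -> R^o} | continuous f}.

Definition weak_space (R : realType) (X : normedModType R) :
    topologicalType :=
  sup_topology (fun f : topological_dual X =>
    Topological.on (initial_topology (sval f : X -> R^o))).

Definition weakly_relatively_compact (R : realType) (X : normedModType R)
    (A : set X) : Prop :=
  compact (closure (A : set (weak_space X))).

Definition seminorm (R : realType) (E : lmodType R) (p : E -> R) : Prop :=
  [/\ forall u, 0 <= p u,
      forall u v, p (u + v) <= p u + p v
    & forall (a : R) u, p (a *: u) = `|a| * p u].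

Definition hamel_basis (R : realType) (E : lmodType R) (e : nat -> E) : Prop :=
  (forall n (a : nat -> R), \sum_(j < n) a j *: e j = 0 ->
     forall j, (j < n)%N -> a j = 0) /\
  (forall v, exists n, exists a : nat -> R, v = \sum_(j < n) a j *: e j).

(* The right factors are the l^1 norms of the finite linear combinations of
   the usual basis of l^1. *)
Definition equivalent_to_l1_basis (R : realType) (E : lmodType R)
    (p : E -> R) (e : nat -> E) : Prop :=
  exists c C : R, [/\ 0 < c, 0 < C &
    forall n (a : nat -> R),
      c * (\sum_(j < n) `|a j|) <= p (\sum_(j < n) a j *: e j) /\
      p (\sum_(j < n) a j *: e j) <= C * (\sum_(j < n) `|a j|)].

(* Here x is an F-subsequence indexed by restrict_family F M: its values
   elsewhere play no role.  The index l stands for l + 1, so M l is the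
   (l+1)-st element of M. *)
Definition generates (R : realType) (X : normedModType R)
    (F : set {fset nat}) (M : nat -> nat) (x : {fset nat} -> X)
    (E : lmodType R) (p : E -> R) (e : nat -> E) : Prop :=
  exists delta : nat -> R,
    [/\ forall n, 0 < delta n, delta @ \oo --> (0 : R) &
      forall (l : nat) (ss : seq {fset nat}) (a : nat -> R),
        (0 < size ss <= l.+1)%N ->
        (forall s, s \in ss -> restrict_family F M s) ->
        plegma ss ->
        (M l <= elt (nth fset0 ss 0) 0)%N ->
        (forall j, (j < size ss)%N -> -1 <= a j <= 1) ->
        `| `|\sum_(j < size ss) a j *: x (nth fset0 ss j)|
           - p (\sum_(j < size ss) a j *: e j) | <= delta l].

Definition generates_l1 (R : realType) (X : normedModType R)
    (F : set {fset nat}) (M : nat -> nat) (x : {fset nat} -> X) : Prop :=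
  exists (E : lmodType R) (p : E -> R) (e : nat -> E),
    [/\ seminorm p, hamel_basis e, generates F M x p e
      & equivalent_to_l1_basis p e].

Definition plegma_block (R : realType) (X : normedModType R) (b : nat -> X)
    (F : set {fset nat}) (M : nat -> nat) (x : {fset nat} -> X) : Prop :=
  (forall s, restrict_family F M s -> finite_set (supp b (x s))) /\
  (forall s1 s2, restrict_family F M s1 -> restrict_family F M s2 ->
     plegma [:: s1; s2] -> set_lt (supp b (x s1)) (supp b (x s2))).

Definition admits_l1_weakly_relatively_compact (R : realType)
    (X : normedModType R) : Prop :=
  exists (F : set {fset nat}) (M : nat -> nat) (x : {fset nat} -> X),
    [/\ regular_thin F, increasing_seq M,
        weakly_relatively_compact (x @` restrict_family F M)
      & generates_l1 F M x].

Definition admits_l1_plegma_block (R : realType) (X : normedModType R)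
    (b : nat -> X) : Prop :=
  exists (F : set {fset nat}) (M : nat -> nat) (x : {fset nat} -> X),
    [/\ regular_thin F, increasing_seq M, plegma_block b F M x
      & generates_l1 F M x].

(* Main.v *)
(* Extending an F-subsequence to the initial segments of its indices by
   weak limits along an ultrafilter, and approximating the increments by
   blocks, one may assume that [x_s = x_0 + \sum_(k < |s|) u_(s|k+1)], where
   the support of [u_t] lies in an interval depending only on [max t], and
   increasing with it.  For a stopping time [beta <= |s|] call [v^beta] the sum
   of the first [beta s] terms.  Suppose that [v^beta] generates l^1 with
   constant [c], and let [p_0 = 0 < p_1 < ...] be the successive times at which
   a new partial sum exceeds [c/4]; by property P and the boundedness of [x],
   boundedly many of them reach [beta].  By a Ramsey argument there is an [i]
   such that, for plegma pairs, [beta s_1 <= p_(i+1) s_2], but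
   [p_i s_2 < beta s_1] (unless the latter already holds for the last one).
   Either [v^(p_i)] generates l^1, and one starts again with [p_i], or
   [v^beta - v^(p_i)] does.  In the second case its terms before [p_(i+1)]
   contribute less than [c/4] and the remaining ones form a plegma block
   subsequence.  The first case cannot recur forever: along an infinite chain
   of plegma pairs the stopping times would decrease strictly. *)

Require Import Defs.
From HB Require Import structures.
From mathcomp Require Import all_boot all_order all_algebra finmap.
From mathcomp Require Import all_classical all_reals all_analysis.
From mathcomp Require Import zify ring lra.

Set Implicit Arguments.
Unset Strict Implicit.
Unset Printing Implicit Defensive.

Import Order.TTheory GRing.Theory Num.Theory.
Import numFieldNormedType.Exports.

Local Open Scope classical_set_scope.
Local Open Scope ring_scope.

(** Infinite sets are handled as increasing sequences [N], and members of the family as prefixes of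
    length [tau N]. Interlaced subsequences of a single [N] then yield plegma tuples, so each linear
    combination becomes a function of one variable. [large] is a filter with a dichotomy for local
    properties: each Ramsey argument is a choice between a set and its complement, and [large_diag]
    later passes to a sequence all of whose subsequences comply.

    Weak compactness serves to produce limits of coordinates. These make an increment small on any
    fixed finite set of coordinates for almost all next terms, so it can be cut to an interval.

    The obstacle is that the elements of a plegma pair interlace, hence so do the supports of the
    two full sums; a plegma block subsequence needs the first sum to stop before the second one
    starts. The portion between two successive passages is what can be discarded cheaply to create
    that gap. Splitting costs half of [c] and the discarded portion a quarter, which leaves [c / 4].
    A restart with an earlier time gives no control of the new constant, so the iteration has to be
    stopped by well-foundedness rather than by an estimate. *)

Definition incr (N : nat -> nat) : Prop := {homo N : i j / (i < j)%N}.

Lemma incrS (N : nat -> nat) : (forall i, (N i < N i.+1)%N) -> incr N.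
Proof. by move=> h; apply: homo_ltn => // ? ? ?; exact: ltn_trans. Qed.

Lemma incr_mono (N : nat -> nat) :
  incr N -> {mono N : i j / (i <= j)%N >-> (i <= j)%N}.
Proof. by move=> h; apply: leq_mono. Qed.

Lemma incr_mono_ltn (N : nat -> nat) :
  incr N -> {mono N : i j / (i < j)%N >-> (i < j)%N}.
Proof. by move=> h; apply: leqW_mono; apply: incr_mono. Qed.

Lemma incr_ge (N : nat -> nat) : incr N -> forall i, (i <= N i)%N.
Proof.
move=> h; elim=> // i IH; apply: (leq_ltn_trans IH); exact: h.
Qed.

Lemma incr_inj (N : nat -> nat) : incr N -> injective N.
Proof. by move=> h; apply: incn_inj; apply: incr_mono. Qed.

Lemma incr_comp (N h : nat -> nat) : incr N -> incr h -> incr (N \o h).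
Proof. by move=> hN hh i j ij /=; apply: hN; apply: hh. Qed.

Lemma mkseq_agree (T : Type) (N N' : nat -> T) k :
  (forall i, (i < k)%N -> N i = N' i) -> mkseq N k = mkseq N' k.
Proof.
move=> h; apply: (@eq_from_nth _ (N 0)) => [|i]; rewrite !size_mkseq // => ik.
by rewrite !nth_mkseq // h.
Qed.

Lemma mkseq_agreeP (T : Type) (N N' : nat -> T) k i :
  mkseq N k = mkseq N' k -> (i < k)%N -> N i = N' i.
Proof.
move=> h ik; have := congr1 (fun s => nth (N 0) s i) h.
by rewrite /= !nth_mkseq.
Qed.

Lemma take_mkseq_le (T : Type) (N : nat -> T) k m :
  (k <= m)%N -> take k (mkseq N m) = mkseq N k.
Proof. by move=> km; rewrite /mkseq -map_take take_iota (minn_idPl km). Qed.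

Lemma incr_mkseq_sorted (N : nat -> nat) k : incr N -> sorted ltn (mkseq N k).
Proof.
move=> h; rewrite /mkseq.
apply: (homo_sorted (e := ltn)) => //; exact: iota_ltn_sorted.
Qed.

(** * Large sets of increasing sequences *)

Lemma free_ultrafilter_exists :
  exists U : set_system nat, UltraFilter U /\ \oo `<=` U.
Proof.
have [U [UU sU]] := ultraFilterLemma (eventually_filter : ProperFilter \oo).
by exists U.
Qed.

Definition free_ultra : set_system nat := sval (cid free_ultrafilter_exists).

#[global] Instance free_ultra_ultra : UltraFilter free_ultra.
Proof. by rewrite /free_ultra; case: cid => U /= []. Qed.

#[global] Instance free_ultra_proper : ProperFilter free_ultra.
Proof. exact: ultra_proper. Qed.

Lemma free_ultra_gt n : free_ultra [set m | (n < m)%N].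
Proof.
rewrite /free_ultra; case: cid => U /= [_]; apply.
by exists n.+1 => // m /=.
Qed.

Lemma free_ultra_gt_seq (s : seq nat) :
  free_ultra [set m | forall i, i \in s -> (i < m)%N].
Proof.
apply: filterS (free_ultra_gt (\max_(i <- s) i)) => m /= hm i si.
by apply: leq_ltn_trans hm; rewrite (big_rem i) //= leq_maxl.
Qed.

(* Almost every extension of [s], in the sense of the iterated quantifier
   "for almost all n_0, for almost all n_1, and so on" of the ultrafilter. *)
Definition tree_large (s : seq nat) (Q : set (nat -> nat)) : Prop :=
  exists2 A : seq nat -> set nat, (forall t, free_ultra (A t)) &
    forall N, incr N -> mkseq N (size s) = s ->
      (forall k, (size s <= k)%N -> A (mkseq N k) (N k)) -> Q N.

Notation large := (tree_large [::]).

Lemma tree_branch (A : seq nat -> set nat) (s : seq nat) :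
  (forall t, free_ultra (A t)) -> sorted ltn s ->
  exists N, [/\ incr N, mkseq N (size s) = s &
    forall k, (size s <= k)%N -> A (mkseq N k) (N k)].
Proof.
move=> hA ss.
(* Freeness of the ultrafilter lets the next term also exceed every entry of [t], which makes the
   branch increasing. *)
have /choice[c hc] : forall t, exists n, A t n /\ forall i, i \in t -> (i < n)%N.
  move=> t; have [n [h1 h2]] := filter_ex (filterI (hA t) (free_ultra_gt_seq t)).
  by exists n.
pose st k := iter k (fun t => rcons t (c t)) s.
pose N i := if (i < size s)%N then nth 0%N s i else c (st (i - size s)%N).
have hN0 : mkseq N (size s) = s.
  apply: (@eq_from_nth _ 0%N); rewrite size_mkseq // => i hi.
  by rewrite nth_mkseq // /N hi.
have hN k : mkseq N (size s + k) = st k.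
  elim: k => [|k IH]; first by rewrite addn0.
  rewrite addnS mkseqS IH /= /N ltnNge leq_addr /=.
  by rewrite addKn.
have hNk k : (size s <= k)%N -> N k = c (mkseq N k).
  move=> hk; rewrite {1}/N ltnNge hk /= -hN subnKC //.
exists N; split => //.
- apply: incrS => i; case: (ltnP i.+1 (size s)) => hi.
    rewrite /N hi (ltnW hi).
    exact: (sortedP 0%N ss).
  rewrite (hNk _ hi); apply: (proj2 (hc _)).
  by apply/mapP; exists i => //; rewrite mem_iota /= add0n.
- by move=> k hk; rewrite hNk //; apply: (proj1 (hc _)).
Qed.

Lemma tree_large_ex (s : seq nat) (Q : set (nat -> nat)) :
  sorted ltn s -> tree_large s Q ->
  exists N, [/\ incr N, mkseq N (size s) = s & Q N].
Proof.
move=> ss [A hA h]; have [N [h1 h2 h3]] := tree_branch hA ss.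
by exists N; split => //; apply: h.
Qed.

Lemma tree_largeS (s : seq nat) (Q Q' : set (nat -> nat)) :
  (forall N, incr N -> mkseq N (size s) = s -> Q N -> Q' N) ->
  tree_large s Q -> tree_large s Q'.
Proof. by move=> h [A hA hQ]; exists A => // N h1 h2 h3; apply: h => //; apply: hQ. Qed.

Lemma tree_largeT (s : seq nat) (Q : set (nat -> nat)) :
  (forall N, incr N -> mkseq N (size s) = s -> Q N) -> tree_large s Q.
Proof. by move=> h; exists (fun=> setT) => [t|N h1 h2 _]; [exact: filterT|exact: h]. Qed.

Lemma tree_largeI (s : seq nat) (Q Q' : set (nat -> nat)) :
  tree_large s Q -> tree_large s Q' -> tree_large s (Q `&` Q').
Proof.
move=> [A hA hQ] [B hB hQ']; exists (fun t => A t `&` B t) => [t|N h1 h2 h3].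
  exact: filterI.
by split; [apply: hQ => // k /h3[]|apply: hQ' => // k /h3[]].
Qed.

Lemma tree_large_next (s : seq nat) (Q : set (nat -> nat)) :
  tree_large s Q -> free_ultra [set n | tree_large (rcons s n) Q].
Proof.
move=> [A hA hQ]; apply: filterS (hA s) => n /= An; exists A => // N h1.
rewrite size_rcons mkseqS => /rcons_inj[h2 h3] h4; apply: hQ => // k.
rewrite leq_eqVlt => /orP[/eqP <-|]; last exact: h4.
by rewrite h2 h3.
Qed.

(** Each [n] comes with its own tree. The glued tree admits only the good [n] at the node [s]; at
    longer nodes it reads the entry that follows [s] to know which tree to obey. *)
Lemma tree_large_glue (s : seq nat) (Q : set (nat -> nat)) :
  free_ultra [set n | tree_large (rcons s n) Q] -> tree_large s Q.
Proof.
move=> hU.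
have /choice[B hB] : forall n, exists A : seq nat -> set nat,
    (forall t, free_ultra (A t)) /\ (tree_large (rcons s n) Q ->
    forall N, incr N -> mkseq N (size s).+1 = rcons s n ->
      (forall k, (size s < k)%N -> A (mkseq N k) (N k)) -> Q N).
  move=> n; case: (pselect (tree_large (rcons s n) Q)) => [[A hA h]|h].
    by exists A; split => // _ N; move: (h N); rewrite size_rcons.
  by exists (fun=> setT); split => // t; exact: filterT.
exists (fun t => if t == s then [set n | tree_large (rcons s n) Q]
  else B (nth 0%N t (size s)) t) => [t|N h1 h2 h3].
  by case: ifP => // _; apply: (proj1 (hB _)).
have hs := h3 _ (leqnn _); rewrite h2 eqxx /= in hs.
apply: (proj2 (hB (N (size s))) hs N h1) => [|k hk]; first by rewrite mkseqS h2.
have := h3 k (ltnW hk); rewrite ifF ?nth_mkseq //.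
by apply/negP => /eqP e; move: hk; rewrite -e size_mkseq ltnn.
Qed.

(* Continuity for the discrete topology on [T]; it is what makes the
   Nash-Williams type dichotomy [tree_large_ultra] available. *)
Definition local (T : Type) (f : (nat -> nat) -> T) : Prop :=
  forall N, incr N -> exists k, forall N', incr N' ->
    (forall i, (i < k)%N -> N i = N' i) -> f N = f N'.

(* A sequence [s] that decides neither [Q] nor its complement has, for almost
   every [n], an undecided extension [rcons s n]; a branch through undecided
   sequences would contradict locality. *)
Lemma tree_large_ultra (s : seq nat) (Q : set (nat -> nat)) :
  sorted ltn s -> local Q -> tree_large s Q \/ tree_large s (~` Q).
Proof.
move=> ss lQ; apply: contrapT => hs.
pose und t := ~ (tree_large t Q \/ tree_large t (~` Q)).
have step t : und t -> free_ultra [set n | und (rcons t n)].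
  move=> ut.
  have [//|h1] := in_ultra_setVsetC [set n | und (rcons t n)] free_ultra_ultra.
  have [h2|h2] := in_ultra_setVsetC [set n | tree_large (rcons t n) Q] free_ultra_ultra.
    by case: ut; left; apply: tree_large_glue.
  case: ut; right; apply: tree_large_glue.
  by apply: filterS (filterI h1 h2) => n [/= /contrapT [|//] hn /(_ hn)].
have hund t : free_ultra [set n | und t -> und (rcons t n)].
  case: (pselect (und t)) => ut; first by apply: filterS (step t ut) => n /=.
  by apply: filterS filterT => n _ /=.
have [N [hN hNs hA]] := tree_branch hund ss.
have uk k : und (mkseq N (size s + k)).
  elim: k => [|k IH]; first by rewrite addn0 hNs.
  by rewrite addnS mkseqS; apply: (hA _ (leq_addr _ _)).
have [k hk] := lQ N hN.
have agr N' : mkseq N' (size (mkseq N (size s + k))) = mkseq N (size s + k) ->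
    forall i, (i < k)%N -> N i = N' i.
  rewrite size_mkseq => h i ik; symmetry.
  by apply: (mkseq_agreeP h); apply: (leq_trans ik); exact: leq_addl.
apply: (uk k); case: (pselect (Q N)) => QN; [left|right]; apply: tree_largeT => N' h1 h2.
- by rewrite -(hk _ h1 (agr _ h2)).
- by rewrite /setC /= -(hk _ h1 (agr _ h2)).
Qed.

(** * Passing to subsequences and diagonalisation *)

Fixpoint subseqs (s : seq nat) : seq (seq nat) :=
  if s is x :: s' then subseqs s' ++ map (cons x) (subseqs s') else [:: [::]].

Lemma mem_subseqs (t s : seq nat) : subseq t s -> t \in subseqs s.
Proof.
elim: s t => [|x s IH] t /=; first by case: t.
rewrite mem_cat; case: t => [|y t]; first by rewrite IH // sub0seq.
case: eqP => [->|_] h; last by rewrite IH.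
by apply/orP; right; apply: map_f; apply: IH.
Qed.

Lemma free_ultra_all (I : eqType) (r : seq I) (P : I -> set nat) :
  (forall i, free_ultra (P i)) ->
  free_ultra [set n | forall i, i \in r -> P i n].
Proof.
move=> h; elim: r => [|a r IH]; first by apply: filterS filterT.
apply: filterS (filterI (h a) IH) => n [h1 h2] i /=.
by rewrite inE => /orP[/eqP ->|/h2].
Qed.

(** When [L (N k)] is chosen, the past of [L] is [mkseq L (N k)]. It contains the past of [L \o N],
    so the tree followed by that subsequence can be consulted in time. *)
Lemma subseq_mkseq_comp (L N : nat -> nat) k : incr N ->
  subseq (mkseq (L \o N) k) (mkseq L (N k)).
Proof.
move=> hN; rewrite /mkseq (map_comp L N); apply: map_subseq.
elim: k => [|k IH]; first by rewrite sub0seq.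
rewrite -[in iota 0 k.+1]addn1 iotaD map_cat /= add0n.
have -> : iota 0 (N k.+1) = iota 0 (N k) ++ iota (N k) (N k.+1 - N k).
  by rewrite -{2}[N k]add0n -iotaD subnKC // ltnW // hN.
apply: cat_subseq => //; rewrite sub1seq mem_iota leqnn /=.
by rewrite subnKC ?hN // ltnW // hN.
Qed.

(* As [L] is chosen recursively against all subsequences of its past, its
   subsequences follow the trees of all the [Q i] at once. *)
Lemma large_diag (Q : nat -> set (nat -> nat)) :
  (forall i, large (Q i)) ->
  exists2 L, incr L &
    forall i N, incr N -> (i <= N 0)%N -> Q i (L \o N).
Proof.
move=> hQ.
have /choice[A hA] : forall i, exists A : seq nat -> set nat,
    (forall t, free_ultra (A t)) /\ forall N, incr N ->
      (forall k, A (mkseq N k) (N k)) -> Q i N.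
  by move=> i; have [A h1 h2] := hQ i; exists A; split => // N h3 h4; apply: h2.
(* Only the finitely many conditions with [i <= size s] can be imposed after [s], whence the
   restriction [i <= N 0]. *)
pose B s : set nat := [set n | forall p,
  p \in allpairs pair (iota 0 (size s).+1) (subseqs s) -> A p.1 p.2 n].
have hB s : free_ultra (B s).
  by apply: (@free_ultra_all _ _ (fun p : nat * seq nat => A p.1 p.2)) => p; apply: (proj1 (hA _)).
have [L [hL _ hLB]] := tree_branch hB (isT : sorted ltn [::]).
exists L => // i N hN hi; apply: (proj2 (hA i)); first exact: incr_comp.
move=> k; apply: (hLB (N k) isT (i, mkseq (L \o N) k)).
apply/allpairsP; exists (i, mkseq (L \o N) k); split => //=.
  by rewrite -[_ :: _]/(iota 0 _.+1) mem_iota size_mkseq /= add0n ltnS (leq_trans hi) // incr_mono.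
by apply: mem_subseqs; exact: subseq_mkseq_comp.
Qed.

(** The new tree imposes at [s] the conditions of all the subsequences of [s], which are finite in
    number; every subsequence of a branch then follows the old tree. *)
Lemma large_hereditary (Q : set (nat -> nat)) (h : nat -> nat) :
  incr h -> large Q -> large [set N | Q (fun k => N (h k))].
Proof.
move=> hh [A hA hQ].
exists (fun s => [set n | forall t, t \in subseqs s -> A t n]) => [s|N hN _ hk].
  exact: free_ultra_all.
apply: hQ => //; first exact: incr_comp.
move=> k _; apply: (hk (h k) isT); apply: mem_subseqs; exact: subseq_mkseq_comp.
Qed.

Lemma large_ge m : large [set N | (m <= N 0)%N].
Proof.
exists (fun=> [set n | (m < n)%N]) => [_|N _ _ /(_ 0%N isT) /ltnW //].
exact: free_ultra_gt.
Qed.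

Lemma tree_large_all (s : seq nat) (I : finType) (Q : I -> set (nat -> nat)) :
  (forall i, tree_large s (Q i)) -> tree_large s [set N | forall i, Q i N].
Proof.
move=> h.
have: tree_large s [set N | forall i, i \in enum I -> Q i N].
  elim: (enum I) => [|a r IH]; first by apply: tree_largeT.
  apply: tree_largeS (tree_largeI (h a) IH) => N _ _ [h1 h2] i.
  by rewrite inE => /orP[/eqP ->|/h2].
by apply: tree_largeS => N _ _ hN i; apply: hN; rewrite mem_enum.
Qed.

(** * Schauder bases *)

Lemma nearooP (P : nat -> Prop) :
  (\forall n \near \oo, P n) <-> exists n0, forall n, (n0 <= n)%N -> P n.
Proof. by split=> [[n0 _ h]|[n0 h]]; exists n0. Qed.

Lemma cvg_seqP (R : realType) (V : normedModType R) (u : nat -> V) (x : V) :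
  u @ \oo --> x <-> forall e : R, 0 < e ->
    exists n0, forall n, (n0 <= n)%N -> `|x - u n| <= e.
Proof.
split=> [/cvgrPdist_le h e e0|h]; first exact/nearooP/h.
by apply/cvgrPdist_le => e e0; apply/nearooP/h.
Qed.

Lemma cvg_bound (R : realType) (V : normedModType R) (u : nat -> V) (x y : V)
    (c : R) n0 :
  u @ \oo --> x -> (forall n, (n0 <= n)%N -> `|y - u n| <= c) -> `|y - x| <= c.
Proof.
move=> /cvg_seqP h hc; apply/ler_addgt0Pr => e e0.
have [n1 h1] := h e e0; pose n := maxn n0 n1.
have -> : y - x = (y - u n) - (x - u n) by rewrite opprB addrA subrK.
apply: (le_trans (ler_normB _ _)); apply: lerD.
  by apply: hc; rewrite leq_maxl.
by apply: h1; rewrite leq_maxr.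
Qed.

Lemma exp2V_lt (R : realType) (C e : R) : 0 < e ->
  exists n, forall m, (n <= m)%N -> C * 2^-1 ^+ m <= e.
Proof.
move=> e0.
have : geometric C (2^-1 : R) @ \oo --> (0 : R).
  by apply: cvg_geometric; rewrite ger0_norm // invf_lt1 // ltr1n.
move=> /cvg_seqP /(_ e e0)[n hn]; exists n => m nm.
by have := hn m nm; rewrite sub0r normrN; apply: le_trans; exact: ler_norm.
Qed.

Lemma geometric_cauchy_cvg (R : realType) (u : nat -> R) (C : R) :
  (forall n m, (n <= m)%N -> `|u m - u n| <= C * 2^-1 ^+ n) ->
  exists l : R, u @ \oo --> l.
Proof.
move=> h; have : cvg (u @ \oo).
  apply: cauchy_cvg; apply: cauchy_exP => e e0.
  have e20 : 0 < e / 2 by rewrite divr_gt0.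
  have [n hn] := exp2V_lt C e20.
  exists (u n); apply/nearooP; exists n => m nm.
  rewrite -ball_normE /ball_ /= distrC.
  apply: (le_lt_trans (h _ _ nm)); apply: (le_lt_trans (hn n (leqnn n))).
  by rewrite ltr_pdivrMr // mulr_natr mulr2n ltrDl.
by move=> /cvg_ex[l hl]; exists l.
Qed.

Section Schauder.
Variables (R : realType) (X : completeNormedModType R) (b : nat -> X).
Hypothesis sb : schauder_basis b.

Local Notation coord := (schauder_coord b).

Definition psum (m : nat) (x : X) : X := \sum_(0 <= i < m) coord x i *: b i.

Lemma schauder_coordP (x : X) : psum^~ x @ \oo --> x.
Proof.
have [a [ha _]] := sb x.
apply: (@xgetPex _ (fun=> 0)
  [set a : nat -> R | series (fun n => a n *: b n) @ \oo --> x]).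
by exists a.
Qed.

Lemma schauder_coord_unique (x : X) (a : nat -> R) :
  (fun m => \sum_(0 <= i < m) a i *: b i) @ \oo --> x -> coord x = a.
Proof.
move=> h; have [a' [_ ha']] := sb x.
by rewrite -(ha' a h) -(ha' _ (@schauder_coordP x)).
Qed.

Lemma schauder_coord_lin (c : R) (x y : X) i :
  coord (c *: x + y) i = c * coord x i + coord y i.
Proof.
rewrite (@schauder_coord_unique _ (fun i => c * coord x i + coord y i)) //.
have -> : (fun m => \sum_(0 <= i < m) (c * coord x i + coord y i) *: b i) =
    (fun m => c *: psum m x + psum m y).
  apply/funext => m; rewrite /psum scaler_sumr -big_split /=.
  by apply: eq_bigr => j _; rewrite scalerDl scalerA.
by apply: cvgD; [apply: cvgZr|]; exact: schauder_coordP.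
Qed.

Lemma schauder_coord0 i : coord 0 i = 0.
Proof.
have := schauder_coord_lin 1 0 0 i; rewrite scaler0 addr0 mul1r => /eqP.
by rewrite -subr_eq0 opprD addrA subrr sub0r oppr_eq0 => /eqP.
Qed.

Lemma schauder_coordZ (c : R) (x : X) i : coord (c *: x) i = c * coord x i.
Proof. by rewrite -[c *: x]addr0 schauder_coord_lin schauder_coord0 addr0. Qed.

Lemma schauder_coordD (x y : X) i : coord (x + y) i = coord x i + coord y i.
Proof. by rewrite -[in LHS](scale1r x) schauder_coord_lin mul1r. Qed.

Lemma schauder_coordN (x : X) i : coord (- x) i = - coord x i.
Proof. by rewrite -scaleN1r schauder_coordZ mulN1r. Qed.

Lemma schauder_coordB (x y : X) i : coord (x - y) i = coord x i - coord y i.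
Proof. by rewrite schauder_coordD schauder_coordN. Qed.

Lemma schauder_coord_sum (I : Type) (r : seq I) (P : pred I) (f : I -> X) i :
  coord (\sum_(j <- r | P j) f j) i = \sum_(j <- r | P j) coord (f j) i.
Proof.
apply: (big_morph (fun x => coord x i)); first by move=> ? ?; exact: schauder_coordD.
exact: schauder_coord0.
Qed.

Lemma schauder_coord_finite (a : nat -> R) m i :
  coord (\sum_(0 <= j < m) a j *: b j) i = if (i < m)%N then a i else 0.
Proof.
rewrite (@schauder_coord_unique _ (fun i => if (i < m)%N then a i else 0)) //.
apply/cvg_seqP => e e0; exists m => n mn.
rewrite [X in _ - X](big_cat_nat _ (n := m)) //= [X in _ - (_ + X)]big_nat_cond.
rewrite [X in _ - (_ + X)]big1 => [|j]; last first.
  by case/andP => /andP[mj _] _; rewrite ltnNge mj /= scale0r.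
rewrite addr0 [X in _ - X]big_nat [X in X - _]big_nat.
rewrite [X in _ - X](eq_bigr (fun j => a j *: b j)) => [|j /andP[_ ->//]].
by rewrite subrr normr0 ltW.
Qed.

Lemma psum_lin m (c : R) (x y : X) : psum m (c *: x + y) = c *: psum m x + psum m y.
Proof.
rewrite /psum scaler_sumr -big_split /=; apply: eq_bigr => j _.
by rewrite schauder_coord_lin scalerDl scalerA.
Qed.

Lemma psum0 m : psum m 0 = 0.
Proof. by rewrite /psum big1 // => j _; rewrite schauder_coord0 scale0r. Qed.

Lemma psumZ m (c : R) (x : X) : psum m (c *: x) = c *: psum m x.
Proof. by rewrite -[c *: x]addr0 psum_lin psum0 addr0. Qed.

Lemma psumD m (x y : X) : psum m (x + y) = psum m x + psum m y.
Proof. by rewrite -[in LHS](scale1r x) psum_lin scale1r. Qed.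

Lemma psumB m (x y : X) : psum m (x - y) = psum m x - psum m y.
Proof. by rewrite psumD -scaleN1r psumZ scaleN1r. Qed.

Lemma psumS m (x : X) : psum m.+1 x = psum m x + coord x m *: b m.
Proof. by rewrite /psum big_nat_recr. Qed.

Lemma schauder_basis_neq0 i : b i != 0.
Proof.
apply/negP => /eqP bi0.
have h : coord 0 = (fun j => (j == i)%:R).
  apply: schauder_coord_unique; apply/cvg_seqP => e e0; exists 0%N => n _.
  rewrite big1 ?subr0 ?normr0 ?ltW // => j _.
  by case: eqP => [->|_]; rewrite ?bi0 ?scaler0 ?scale0r.
have := congr1 (fun f => f i) h; rewrite schauder_coord0 eqxx => /eqP.
by rewrite eq_sym oner_eq0.
Qed.

Lemma psum_pointwise_bounded (x : X) : exists n : nat, forall m, `|psum m x| <= n%:R.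
Proof.
have /cvg_seqP /(_ 1 ltr01)[n0 h] := @schauder_coordP x.
pose M := `|x| + 1 + \sum_(i < n0) `|psum i x|.
have M0 : 0 <= M by rewrite !addr_ge0 // sumr_ge0.
exists (Num.truncn M).+1 => m.
apply: le_trans (ltW (truncnS_gt _)); rewrite /M.
case: (ltnP m n0) => hm.
  rewrite (bigD1 (Ordinal hm)) //= addrCA ler_wpDr //.
  by rewrite !addr_ge0 // sumr_ge0.
rewrite ler_wpDr ?sumr_ge0 //.
have -> : psum m x = x - (x - psum m x) by rewrite opprB addrCA subrr addr0.
by apply: (le_trans (ler_normB _ _)); apply: lerD => //; exact: h.
Qed.

(* Baire's theorem for the sets where all partial sums are bounded by [n]. *)
Lemma psum_dense_bounded : exists2 K : R, 0 < K &
  forall (y : X) (e : R), 0 < e ->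
    exists2 a : X, (forall m, `|psum m a| <= K * `|y|) & `|y - a| <= e.
Proof.
pose A n := [set x : X | forall m, `|psum m x| <= n%:R].
have [n [x0 [r [r0 hr]]]] : exists n (x0 : X) (r : R), 0 < r /\
    ball x0 r `<=` closure (A n).
  have nd : exists i, ~ dense (~` closure (A i)).
    apply: contrapT => /forallNP hd.
    have /Baire : forall i, open (~` closure (A i)) /\ dense (~` closure (A i)).
      move=> i; split; last exact: contrapT (hd i).
      by apply: closed_openC; exact: closed_closure.
    move=> /(_ setT) []; [by exists 0|exact: openT|].
    move=> x [_ hx]; have [n hn] := psum_pointwise_bounded x.
    by apply: (hx n I); apply: subset_closure.
  have [i hi] := nd; have [V [[x Vx] hV]] := denseNE hi.
  have /nbhs_ballP[r r0 bxr] := open_nbhs_nbhs Vx.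
  exists i, x, r; split => // z /bxr Vz; apply: contrapT => hz.
  by have : (V `&` ~` closure (A i)) z by []; rewrite hV.
(* Both [x0 + y] and [x0] lie in the closure of [A n]; the difference of nearby points of [A n]
   approximates [y] and has partial sums bounded by [n + n]. *)
have app (y : X) (e : R) : `|y| < r -> 0 < e ->
    exists2 a : X, (forall m, `|psum m a| <= n%:R + n%:R) & `|y - a| <= e.
  move=> yr e0; have e20 : 0 < e / 2 by rewrite divr_gt0.
  have h1 : ball x0 r (x0 + y).
    by rewrite -ball_normE /ball_ /= opprD addrA subrr sub0r normrN.
  have [a1 [Aa1 Ba1]] := hr _ h1 _ (nbhsx_ballx (x0 + y) (e / 2) e20).
  have [a2 [Aa2 Ba2]] := hr _ (ballxx _ r0) _ (nbhsx_ballx x0 (e / 2) e20).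
  exists (a1 - a2) => [m|].
    by rewrite psumB; apply: (le_trans (ler_normB _ _)); apply: lerD.
  have -> : y - (a1 - a2) = (x0 + y - a1) - (x0 - a2).
    by rewrite !opprB -(addrA x0) [RHS]addrC subrKA addrCA.
  rewrite [e]splitr; apply: (le_trans (ler_normB _ _)).
  move: Ba1 Ba2; rewrite -!ball_normE /ball_ /= => /ltW ? /ltW ?.
  exact: lerD.
(* Rescaling [y] to norm [r / 2] costs the factor [2 / r] times the norm of [y]; the added [1] keeps
   the constant positive when [n = 0]. *)
exists ((n%:R + n%:R) * 2 / r + 1) => [|y e e0].
  by rewrite ltr_wpDl // !mulr_ge0 // ?addr_ge0 // invr_ge0 ltW.
have [->|y0] := eqVneq y 0.
  by exists 0 => [m|]; rewrite ?psum0 ?subr0 normr0 ?mulr0 // ltW.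
have ny : 0 < `|y| by rewrite normr_gt0.
pose t := r / (2 * `|y|).
have t0 : 0 < t by rewrite divr_gt0 // mulr_gt0.
have ty : `|t *: y| < r.
  rewrite normrZ gtr0_norm // /t invfM mulrA mulfVK ?gt_eqF //.
  by rewrite ltr_pdivrMr // mulr_natr mulr2n ltrDl.
have [a h1 h2] := app (t *: y) (t * e) ty (mulr_gt0 t0 e0).
exists (t^-1 *: a) => [m|].
  rewrite psumZ normrZ gtr0_norm ?invr_gt0 // mulrDl.
  rewrite ler_wpDr ?mulr_ge0 //.
  have -> : (n%:R + n%:R) * 2 / r * `|y| = t^-1 * (n%:R + n%:R).
    by rewrite /t; field; rewrite !gt_eqF.
  by rewrite ler_pM2l // invr_gt0.
have -> : y - t^-1 *: a = t^-1 *: (t *: y - a).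
  by rewrite scalerBr scalerA mulVf ?gt_eqF // scale1r.
by rewrite normrZ gtr0_norm ?invr_gt0 // mulrC ler_pdivrMr // mulrC.
Qed.


(* [x] is the sum of vectors [a j] of geometrically decreasing norms whose
   partial sums are controlled by [psum_dense_bounded]; the series of their
   coordinates are then the coordinates of [x]. *)
Lemma psum_bounded : exists2 C : R, 0 < C & forall m (x : X), `|psum m x| <= C * `|x|.
Proof.
have [K K0 hK] := psum_dense_bounded.
exists (2 * K) => [|m0 x]; first by rewrite mulr_gt0.
have [->|x0] := eqVneq x 0; first by rewrite psum0 // !normr0 mulr0.
have nx : 0 < `|x| by rewrite normr_gt0.
pose e j : R := `|x| * 2^-1 ^+ j.+1.
have e0 j : 0 < e j by rewrite mulr_gt0 // exprn_gt0 // invr_gt0.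
have /choice[g hg] : forall yj : X * nat, exists a : X,
    (forall m, `|psum m a| <= K * `|yj.1|) /\ `|yj.1 - a| <= e yj.2.
  by move=> [y j]; have [a h1 h2] := hK y (e j) (e0 j); exists a.
pose y := fix y j := if j is j'.+1 then y j' - g (y j', j') else x.
pose a j := g (y j, j).
have yb j : `|y j| <= `|x| * 2^-1 ^+ j.
  by case: j => [|j]; rewrite ?expr0 ?mulr1 //; exact: (proj2 (hg (y j, j))).
have ab m j : `|psum m (a j)| <= K * `|x| * 2^-1 ^+ j.
  rewrite -mulrA; apply: (le_trans (proj1 (hg (y j, j)) m)); rewrite ler_pM2l //; exact: yb.
pose S J := \sum_(0 <= j < J) a j.
have Sy J : x - S J = y J.
  elim: J => [|J IH]; first by rewrite /S big_nil subr0.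
  by rewrite /S big_nat_recr //= opprD addrA IH.
pose D : R := 2 * (K * `|x|).
have D0 : 0 < D by rewrite !mulr_gt0.
(* Each term is at most [D * 2^-1 ^+ j - D * 2^-1 ^+ j.+1], so the geometric tail telescopes and the
   induction closes without loss. *)
have Sd m J J' : (J <= J')%N ->
    `|psum m (S J') - psum m (S J)| <= D * 2^-1 ^+ J - D * 2^-1 ^+ J'.
  move=> /subnKC <-; elim: (J' - J)%N => [|n IH]; first by rewrite addn0 !subrr normr0.
  rewrite addnS /S big_nat_recr //= psumD //.
  rewrite addrAC; apply: (le_trans (ler_normD _ _)).
  apply: (le_trans (lerD IH (ab m (J + n)%N))).
  rewrite exprS /D; lra.
have Sd' m J J' : (J <= J')%N -> `|psum m (S J') - psum m (S J)| <= D * 2^-1 ^+ J.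
  move=> h; apply: (le_trans (Sd m J J' h)).
  by rewrite gerBl // mulr_ge0 ?ltW // exprn_gt0 // invr_gt0.
have cd i : exists l : R, (fun J => coord (S J) i) @ \oo --> l.
  have nb : 0 < `|b i| by rewrite normr_gt0 schauder_basis_neq0.
  apply: (@geometric_cauchy_cvg _ _ ((2 * D) / `|b i|)) => J J' h.
  rewrite mulrAC ler_pdivlMr // -normrZ scalerBl.
  have e1 u : coord u i *: b i = psum i.+1 u - psum i u by rewrite psumS addrC addKr.
  rewrite !e1.
  have -> : psum i.+1 (S J') - psum i (S J') - (psum i.+1 (S J) - psum i (S J)) =
     (psum i.+1 (S J') - psum i.+1 (S J)) - (psum i (S J') - psum i (S J)).
    by rewrite !opprB addrACA [- _ + _]addrC addrACA.
  apply: (le_trans (ler_normB _ _)).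
  have := lerD (Sd' i.+1 J J' h) (Sd' i J J' h); lra.
have /choice[sg hsg] := cd.
pose Q m := \sum_(0 <= i < m) sg i *: b i.
have QS m : (fun J => psum m (S J)) @ \oo --> Q m.
  elim: m => [|m IH].
    rewrite /Q big_nil (_ : (fun _ => _) = cst 0); first exact: cvg_cst.
    by apply/funext => J; rewrite /psum big_nil.
  rewrite /Q big_nat_recr //= (_ : (fun _ => _) =
     (fun J => psum m (S J) + coord (S J) m *: b m)).
    by apply: cvgD; [exact: IH|apply: cvgZl; exact: hsg].
  by apply/funext => J; rewrite psumS.
have QSd m J : `|psum m (S J) - Q m| <= D * 2^-1 ^+ J.
  by apply: (cvg_bound (n0 := J) (QS m)) => J' h; rewrite distrC; exact: Sd'.
(* The bound [QSd] is uniform in [m], so [J] can be fixed before [m]: this is the exchange of the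
   limits in [J] and [m]. *)
have Qx : coord x = sg.
  apply: schauder_coord_unique; apply/cvg_seqP => r r0.
  have r30 : 0 < r / 3 by rewrite divr_gt0.
  have [J1 hJ1] := exp2V_lt D r30.
  have [J2 hJ2] := exp2V_lt `|x| r30.
  pose J := maxn J1 J2.
  have /cvg_seqP /(_ _ r30)[n0 hn0] := @schauder_coordP (S J).
  exists n0 => m hm.
  have -> : x - Q m = (x - S J) + (S J - psum m (S J)) + (psum m (S J) - Q m).
    by rewrite !subrKA.
  apply: (le_trans (ler_normD _ _)).
  have h1 := le_trans (QSd m J) (hJ1 J (leq_maxl _ _)).
  have h2 : `|x - S J| <= r / 3 by rewrite Sy (le_trans (yb J)) // hJ2 // leq_maxr.
  have h3 := hn0 m hm.
  have h4 := ler_normD (x - S J) (S J - psum m (S J)).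
  have h5 := lerD (le_trans h4 (lerD h2 h3)) h1.
  apply: (le_trans h5); lra.
rewrite [psum m0 x](_ : _ = Q m0); last by rewrite /psum Qx.
have := QSd m0 0%N; rewrite expr0 mulr1 /S big_nil psum0 sub0r normrN.
by rewrite /D mulrA.
Qed.

Lemma schauder_coord_bounded i :
  exists2 C : R, 0 < C & forall x, `|coord x i| <= C * `|x|.
Proof.
have [C C0 hC] := psum_bounded.
have nb : 0 < `|b i| by rewrite normr_gt0 schauder_basis_neq0.
exists (2 * C / `|b i|) => [|x]; first by rewrite !mulr_gt0 // invr_gt0.
rewrite mulrAC ler_pdivlMr // -normrZ.
have -> : coord x i *: b i = psum i.+1 x - psum i x by rewrite psumS addrC addKr.
apply: (le_trans (ler_normB _ _)).
have := lerD (hC i.+1 x) (hC i x); lra.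
Qed.

End Schauder.

(** * Lower l^1 estimates along plegma tuples *)

Lemma local_map (T T' : Type) (h : T -> T') (f : (nat -> nat) -> T) :
  local f -> local (fun N => h (f N)).
Proof. by move=> lf N /lf[k hk]; exists k => N' hN' ag; rewrite (hk N'). Qed.

Lemma local_map2 (T T' T'' : Type) (h : T -> T' -> T'')
    (f : (nat -> nat) -> T) (g : (nat -> nat) -> T') :
  local f -> local g -> local (fun N => h (f N) (g N)).
Proof.
move=> lf lg N hN; have [k hk] := lf N hN; have [k' hk'] := lg N hN.
exists (maxn k k') => N' hN' ag.
rewrite (hk N') //; last by move=> i ik; apply: ag; rewrite leq_max ik.
by rewrite (hk' N') // => i ik; apply: ag; rewrite leq_max ik orbT.
Qed.

Lemma local_cst (T : Type) (x : T) : local (fun=> x).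
Proof. by move=> N _; exists 0%N. Qed.

Lemma local_sum (V : nmodType) l (f : nat -> (nat -> nat) -> V) :
  (forall j, local (f j)) -> local (fun N => \sum_(j < l) f j N).
Proof.
move=> hf; elim: l => [|l IH].
  rewrite (_ : (fun N => _) = fun=> 0); first exact: local_cst.
  by apply/funext => N; rewrite big_ord0.
rewrite (_ : (fun N => _) = fun N => \sum_(j < l) f j N + f l N).
  exact: (local_map2 +%R).
by apply/funext => N; rewrite big_ord_recr.
Qed.

(* [sub l 0 N, ..., sub l l.-1 N] are interlaced, so that their initial
   segments form plegma tuples. *)
Definition sub (l j : nat) (N : nat -> nat) : nat -> nat :=
  fun k => N (l * k + j)%N.

Lemma incr_affine l j : (0 < l)%N -> incr (fun k => l * k + j)%N.
Proof. by move=> l0 i k ik; rewrite ltn_add2r ltn_pmul2l. Qed.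

Lemma incr_sub l j N : (0 < l)%N -> incr N -> incr (sub l j N).
Proof. by move=> l0 hN; apply: (incr_comp hN (incr_affine j l0)). Qed.

Lemma sub10 N : sub 1 0 N = N.
Proof. by apply/funext => k; rewrite /sub mul1n addn0. Qed.

Lemma local_comp (T : Type) (f : (nat -> nat) -> T) (h : nat -> nat) :
  incr h -> local f -> local (fun N => f (fun k => N (h k))).
Proof.
move=> hh lf N hN; have [k hk] := lf _ (incr_comp hN hh).
exists (h k) => N' hN' ag; apply: hk; first exact: incr_comp.
by move=> i ik; apply: ag; apply: hh.
Qed.

Lemma local_sub (T : Type) (f : (nat -> nat) -> T) l j :
  (0 < l)%N -> local f -> local (fun N => f (sub l j N)).
Proof. by move=> l0; apply: local_comp; apply: incr_affine. Qed.

(** With [t] read as [m * k + i], the map [h] sends it to [n * k + p i]; it increases because a row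
    of length [n] ends before the next one begins. Thus a large property of [m]-tuples holds for the
    chosen members of an interlaced [n]-tuple. *)
Lemma sub_select m n (p : nat -> nat) : (0 < m)%N ->
  (forall i j, (i < j < m)%N -> (p i < p j)%N) ->
  (forall i, (i < m)%N -> (p i < n)%N) ->
  exists2 h, incr h &
    forall N i, (i < m)%N -> sub m i (fun k => N (h k)) = sub n (p i) N.
Proof.
move=> m0 hp hn; exists (fun t => n * (t %/ m) + p (t %% m))%N.
  apply: incrS => t.
  have tm : (t %% m < m)%N by rewrite ltn_mod.
  case: (ltnP (t %% m).+1 m) => h.
    have e : t.+1 = ((t %/ m) * m + (t %% m).+1)%N by rewrite addnS -divn_eq.
    rewrite e divnMDl // modnMDl (divn_small h) (modn_small h) addn0 ltn_add2l.
    by apply: hp; rewrite leqnn.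
  have e1 : (t %% m).+1 = m by apply/eqP; rewrite eqn_leq tm h.
  have e : t.+1 = ((t %/ m).+1 * m)%N by rewrite mulSn [(m + _)%N]addnC -[in RHS]e1 addnS e1 -divn_eq.
  rewrite e mulnK // modnMl mulnS.
  by have := hn _ tm; lia.
move=> N i im; apply/funext => k; rewrite /sub; congr (N _).
by rewrite [(m * k)%N]mulnC divnMDl // modnMDl (divn_small im) (modn_small im) addn0.
Qed.

Section L1Lower.
Variables (R : realType) (X : normedModType R).
Implicit Types (v r : (nat -> nat) -> X) (a : nat -> R).

Definition comb v a l N : X := \sum_(j < l) a j *: v (sub l j N).

Lemma local_comb v a l : local v -> local (comb v a l).
Proof.
case: l => [|l] lv.
  rewrite (_ : comb v a 0 = fun=> 0); first exact: local_cst.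
  by apply/funext => N; rewrite /comb big_ord0.
apply: (@local_sum _ l.+1 (fun j N => a j *: v (sub l.+1 j N))) => j.
by apply: (local_map (GRing.scale (a j))); apply: local_sub.
Qed.

Lemma large_comb_select (Q : X -> Prop) v a m n (p : nat -> nat) : (0 < m)%N ->
  (forall i j, (i < j < m)%N -> (p i < p j)%N) ->
  (forall i, (i < m)%N -> (p i < n)%N) ->
  large [set N | Q (comb v a m N)] ->
  large [set N | Q (\sum_(i < m) a i *: v (sub n (p i) N))].
Proof.
move=> m0 hp hn; have [h hh e] := sub_select m0 hp hn.
move=> /(large_hereditary hh); apply: tree_largeS => N _ _ /=.
rewrite [comb _ _ _ _](_ : _ = \sum_(i < m) a i *: v (sub n (p i) N)) //.
by apply: eq_bigr => i _; rewrite e.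
Qed.

(** The large set may depend on [l] and [a], so that the dichotomy applies to one combination at a
    time. This suffices because the lower estimate passes to the limit norm for each combination
    separately. *)
Definition lower v (c : R) : Prop := forall l a, (0 < l)%N ->
  large [set N | c * (\sum_(j < l) `|a j|) <= `|comb v a l N|].

Lemma not_lower v c l a : local v ->
  ~ large [set N | c * (\sum_(j < l) `|a j|) <= `|comb v a l N|] ->
  large [set N | `|comb v a l N| < c * (\sum_(j < l) `|a j|)].
Proof.
move=> lv hn.
have lQ := local_map (fun x : X => c * (\sum_(j < l) `|a j|) <= `|x| : Prop)
  (local_comb a l lv).
have [//|] := tree_large_ultra (isT : sorted ltn [::]) lQ.
by apply: tree_largeS => N _ _ /= /negP; rewrite -ltNge.
Qed.

Lemma lower_perturb v r c e : (forall N, incr N -> `|v N - r N| <= e) ->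
  lower v c -> lower r (c - e).
Proof.
move=> hvr lv l a l0; apply: tree_largeS (lv l a l0) => N hN _ /=.
have : `|comb v a l N - comb r a l N| <= e * \sum_(j < l) `|a j|.
  rewrite /comb -sumrB; apply: (le_trans (ler_norm_sum _ _ _)).
  rewrite mulr_sumr; apply: ler_sum => j _.
  rewrite -scalerBr normrZ mulrC ler_wpM2r //; apply: hvr; exact: incr_sub.
have := lerB_dist (comb v a l N) (comb r a l N).
rewrite mulrBl => h1 h2 h3.
have := le_trans h1 h2; lra.
Qed.

Lemma sum_mul_ord (V : nmodType) k l (F : nat -> V) :
  \sum_(t < k * l) F t = \sum_(i < k) \sum_(j < l) F (i * l + j)%N.
Proof.
elim: k => [|k IH]; first by rewrite mul0n !big_ord0.
rewrite big_ord_recr /= -IH mulSnr big_split_ord /=.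
by congr (_ + _); apply: eq_bigr => j _.
Qed.

(* If [v] is far from l^1, a small combination [a] of [v] is repeated along
   the blocks of a [k * l]-tuple; averaging the copies of a combination of [r]
   with the weights [a] leaves only [r] to carry the lower estimate. *)
Lemma lower_split v r c : 0 < c -> local v -> local r ->
  lower (fun N => v N + r N) c ->
  (exists2 c', 0 < c' & lower v c') \/ lower r (c / 2).
Proof.
move=> c0 lv lr lvr.
case: (pselect (exists2 c', 0 < c' & lower v c')) => hv; [by left|right].
move=> k d k0; apply: contrapT => hr.
have {}hr := not_lower lr hr.
(* In the final estimate the part from [v] gets at most [c / 4] and the part from [r] at most
   [c / 2], in total less than [c]. *)
have [l [a [l0 hva]]] : exists l a, (0 < l)%N /\
    ~ large [set N | c / 4 * (\sum_(j < l) `|a j|) <= `|comb v a l N|].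
  apply: contrapT => hn; apply: hv; exists (c / 4); first by rewrite divr_gt0.
  by move=> l a l0; apply: contrapT => hn'; apply: hn; exists l, a.
have {}hva := not_lower lv hva.
have kl0 : (0 < k * l)%N by rewrite muln_gt0 k0.
pose g t := d (t %/ l)%N * a (t %% l)%N.
have h1 := lvr (k * l)%N g kl0.
have h2 : large [set N | forall j : 'I_l,
    `|\sum_(i < k) d i *: r (sub (k * l) (i * l + j)%N N)| < c / 2 * (\sum_(i < k) `|d i|)].
  apply: tree_large_all => j.
  apply: (@large_comb_select (fun x => `|x| < _) r d k (k * l) (fun i => i * l + j)%N) => //.
    by move=> i i' /andP[ii' _]; rewrite ltn_add2r ltn_pmul2r.
  move=> i ik; apply: (@leq_trans (i.+1 * l)%N); last by rewrite leq_mul2r ik orbT.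
  by rewrite mulSnr ltn_add2l.
have h3 : large [set N | forall i : 'I_k,
    `|\sum_(j < l) a j *: v (sub (k * l) (i * l + j)%N N)| < c / 4 * (\sum_(j < l) `|a j|)].
  apply: tree_large_all => i.
  apply: (@large_comb_select (fun x => `|x| < _) v a l (k * l) (fun j => i * l + j)%N) => //.
    by move=> j j' /andP[jj' _]; rewrite ltn_add2l.
  move=> j jl; apply: (@leq_trans (i.+1 * l)%N); last by rewrite leq_mul2r ltn_ord orbT.
  by rewrite mulSnr ltn_add2l.
have [N [hN _ [H1 [H2 H3]]]] := tree_large_ex (isT : sorted ltn [::])
  (tree_largeI h1 (tree_largeI h2 h3)).
set A := \sum_(j < l) `|a j| in H3; set D := \sum_(i < k) `|d i| in H2.
(* Positivity is read off the strict inequality [H2], since a norm cannot be strictly below zero;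
   likewise for [A] with [H3]. *)
have D0 : 0 < D.
  by have := le_lt_trans (normr_ge0 _) (H2 (Ordinal l0)); rewrite pmulr_rgt0 // divr_gt0.
have A0 : 0 < A.
  by have := le_lt_trans (normr_ge0 _) (H3 (Ordinal k0)); rewrite pmulr_rgt0 // divr_gt0.
move: H1; rewrite /comb /= (sum_mul_ord k l (fun t => `|g t|)).
rewrite (sum_mul_ord k l (fun t => g t *: (v (sub (k * l) t N) + r (sub (k * l) t N)))).
have dm (i : 'I_k) (j : 'I_l) : g (i * l + j)%N = d i * a j.
  by rewrite /g divnMDl // modnMDl (divn_small (ltn_ord j)) (modn_small (ltn_ord j)) addn0.
have -> : \sum_(i < k) \sum_(j < l) `|g (i * l + j)%N| = A * D.
  rewrite mulrC /D /A mulr_suml; apply: eq_bigr => i _; rewrite mulr_sumr.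
  by apply: eq_bigr => j _; rewrite dm normrM.
under eq_bigr => i _ do (under eq_bigr => j _ do rewrite dm scalerDr; rewrite big_split /=).
rewrite big_split /=.
have B1 : `|\sum_(i < k) \sum_(j < l) (d i * a j) *: v (sub (k * l) (i * l + j)%N N)|
    <= c / 4 * A * D.
  apply: (le_trans (ler_norm_sum _ _ _)); rewrite mulr_sumr; apply: ler_sum => i _.
  under eq_bigr => j _ do rewrite -scalerA.
  by rewrite -scaler_sumr normrZ mulrC ler_wpM2r // ltW // H3.
have B2 : `|\sum_(i < k) \sum_(j < l) (d i * a j) *: r (sub (k * l) (i * l + j)%N N)|
    <= c / 2 * D * A.
  rewrite exchange_big /=.
  apply: (le_trans (ler_norm_sum _ _ _)); rewrite mulr_sumr; apply: ler_sum => j _.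
  under eq_bigr => i _ do rewrite mulrC -scalerA.
  by rewrite -scaler_sumr normrZ mulrC ler_wpM2r // ltW // H2.
move=> H; have := le_trans H (le_trans (ler_normD _ _) (lerD B1 B2)).
have := mulr_gt0 c0 (mulr_gt0 A0 D0).
rewrite -!mulrA [D * A]mulrC; set z := A * D; nra.
Qed.

End L1Lower.

(** * Extraction of a block by stopping times *)

Definition determined (T : Type) (tau : (nat -> nat) -> nat)
    (f : (nat -> nat) -> T) : Prop :=
  forall N N', incr N -> incr N' -> (forall i, (i < tau N)%N -> N i = N' i) ->
    f N = f N'.

Lemma determined_local (T : Type) tau (f : (nat -> nat) -> T) :
  determined tau f -> local f.
Proof. by move=> h N hN; exists (tau N) => N' hN' ag; apply: h. Qed.

Section Core.
Variables (R : realType) (X : completeNormedModType R) (b : nat -> X).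
Hypothesis sb : schauder_basis b.
Local Notation coord := (schauder_coord b).

Lemma psum_id m y : (forall j, coord y j != 0 -> (j < m)%N) -> psum b m y = y.
Proof.
move=> h; apply/eqP; rewrite -subr_eq0 -normr_le0.
apply: (cvg_bound (n0 := m) (@schauder_coordP _ _ _ sb y)) => n mn.
rewrite /psum [X in _ - X](big_cat_nat _ (n := m)) //= [X in _ - (_ + X)]big_nat_cond.
rewrite [X in _ - (_ + X)]big1 ?addr0 ?subrr ?normr0 // => j /andP[/andP[mj _] _].
case: (eqVneq (coord y j) 0) => [->|/h]; first by rewrite scale0r.
by rewrite ltnNge mj.
Qed.

Lemma psum_eq0 m y : (forall j, coord y j != 0 -> (m <= j)%N) -> psum b m y = 0.
Proof.
move=> h; rewrite /psum big_nat big1 // => j /andP[_ jm].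
case: (eqVneq (coord y j) 0) => [->|/h]; first by rewrite scale0r.
by rewrite leqNgt jm.
Qed.

Variables (u : seq nat -> X) (mm : nat -> nat) (tau : (nat -> nat) -> nat).
Hypothesis mm_mono : {homo mm : i j / (i <= j)%N}.
Hypothesis u_supp : forall N k, incr N -> (k < tau N)%N -> forall j,
  coord (u (mkseq N k.+1)) j != 0 -> (mm (N k) <= j < mm (N k).+1)%N.
Hypothesis det_tau : determined tau tau.

Definition block (N : nat -> nat) (p q : nat) : X :=
  \sum_(p <= k < q) u (mkseq N k.+1).

Lemma block_cat N p q r : (p <= q <= r)%N ->
  block N p r = block N p q + block N q r.
Proof. by move=> /andP[pq qr]; rewrite /block (big_cat_nat _ (n := q)). Qed.

Lemma block_agree N N' p q : (forall i, (i < q)%N -> N i = N' i) ->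
  block N p q = block N' p q.
Proof.
move=> ag; rewrite /block !big_nat; apply: eq_bigr => k /andP[_ kq].
by congr (u _); apply: mkseq_agree => i ik; apply: ag; apply: leq_trans kq.
Qed.

Lemma block_coord N p q j : incr N -> (q <= tau N)%N ->
  coord (block N p q) j != 0 ->
  exists2 k, (p <= k < q)%N & (mm (N k) <= j < mm (N k).+1)%N.
Proof.
move=> hN qt; rewrite schauder_coord_sum //.
case: (pselect (exists2 k, (p <= k < q)%N & coord (u (mkseq N k.+1)) j != 0)).
  move=> [k kpq hk] _; exists k => //; apply: u_supp hk => //.
  by case/andP: kpq => _ kq; exact: leq_trans qt.
move=> hn; rewrite big_nat big1 ?eqxx // => k hk.
by case: (eqVneq (coord (u (mkseq N k.+1)) j) 0) => // hk'; case: hn; exists k.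
Qed.

Lemma block_supp N p q j : incr N -> (q <= tau N)%N ->
  coord (block N p q) j != 0 -> (mm (N p) <= j < mm (N q))%N.
Proof.
move=> hN qt /(block_coord hN qt)[k /andP[pk kq] /andP[h1 h2]].
rewrite (leq_trans (mm_mono _) h1) ?incr_mono //=.
by apply: (leq_trans h2); apply: mm_mono; apply: hN.
Qed.

Lemma psum_block N p q : incr N -> (p <= q <= tau N)%N ->
  psum b (mm (N p)) (block N 0 q) = block N 0 p.
Proof.
move=> hN /andP[pq qt]; rewrite (@block_cat _ 0 p q) ?pq // psumD //.
rewrite psum_id => [|j /(block_supp hN (leq_trans pq qt))/andP[]//].
by rewrite psum_eq0 ?addr0 // => j /(block_supp hN qt)/andP[].
Qed.

Variables (K : R) (K0 : 0 < K).
Hypothesis block_bound : forall N, incr N -> `|block N 0 (tau N)| <= K.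

(** By [psum_block], each initial block is a Schauder partial sum of the full block, and the partial
    sum operators are uniformly bounded. *)
Lemma block0_bounded : exists2 C : R, 0 < C &
  forall N p, incr N -> (p <= tau N)%N -> `|block N 0 p| <= C.
Proof.
have [C C0 hC] := psum_bounded sb.
exists (C * K) => [|N p hN pt]; first exact: mulr_gt0.
rewrite -(@psum_block N p (tau N)) // ?pt //=.
by apply: (le_trans (hC _ _)); rewrite ler_pM2l // block_bound.
Qed.

(** The dependence allowed is on the first [tau N] terms rather than the first [beta N]: the time
    built from [(p i.+1 N).-1] in [l1_block_step] looks one step ahead. *)
Definition stopping (beta : (nat -> nat) -> nat) : Prop :=
  determined tau beta /\ forall N, incr N -> (beta N <= tau N)%N.

Lemma determined_block alpha beta : stopping alpha -> stopping beta ->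
  determined tau (fun N => block N (alpha N) (beta N)).
Proof.
move=> [da la] [db lb] N N' hN hN' ag; rewrite (da _ _ hN hN' ag) -(db _ _ hN hN' ag).
apply: block_agree => i ib; apply: ag; apply: (leq_trans ib); exact: lb.
Qed.

Lemma stopping_local beta : stopping beta -> local beta.
Proof. by move=> [d _]; apply: determined_local d. Qed.

Section Passages.
Variables (delta : R) (beta : (nat -> nat) -> nat).
Hypothesis sbeta : stopping beta.

(* The value is [beta N] when no block starting at [p N] exceeds [delta]. *)
Definition passage (p : (nat -> nat) -> nat) (N : nat -> nat) : nat :=
  find (fun q => (p N < q)%N && (delta < `|block N (p N) q|)) (iota 0 (beta N)).

Definition passages (i : nat) : (nat -> nat) -> nat := iter i passage (fun=> 0%N).

Lemma passage_le p N : (passage p N <= beta N)%N.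
Proof. by rewrite -[X in (_ <= X)%N](size_iota 0) find_size. Qed.

Lemma passage_lt p N : (passage p N < beta N)%N ->
  (p N < passage p N)%N /\ delta < `|block N (p N) (passage p N)|.
Proof.
rewrite -{1}[X in (_ < X)%N](size_iota 0) -has_find => /(nth_find 0%N).
have : (passage p N <= beta N)%N := passage_le p N.
rewrite leq_eqVlt => /orP[/eqP e|h].
  by rewrite -/(passage p N) nth_default ?size_iota ?e.
by rewrite -/(passage p N) nth_iota // add0n => /andP[].
Qed.

Lemma passage_ge p N : (p N <= beta N)%N -> (p N <= passage p N)%N.
Proof.
move=> h; have := passage_le p N; rewrite leq_eqVlt => /orP[/eqP -> //|].
by move=> /passage_lt[/ltnW].
Qed.

Lemma passage_before p N q : 0 <= delta -> (q < passage p N)%N -> (p N <= q)%N ->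
  `|block N (p N) q| <= delta.
Proof.
move=> d0 h; rewrite leq_eqVlt => /orP[/eqP <-|pq].
  by rewrite /block big_geq ?normr0.
have := before_find 0%N h; rewrite nth_iota; last exact: (leq_trans h (passage_le _ _)).
by rewrite add0n pq /= => /negbT; rewrite -leNgt.
Qed.

Lemma stopping_passage p : stopping p -> stopping (passage p).
Proof.
move=> [dp lp]; split=> [N N' hN hN' ag|N hN]; last first.
  exact: (leq_trans (passage_le _ _) ((proj2 sbeta) N hN)).
rewrite /passage -((proj1 sbeta) _ _ hN hN' ag) -(dp _ _ hN hN' ag).
apply: eq_in_find => q; rewrite mem_iota add0n => /= qb.
rewrite (@block_agree N N') // => i iq; apply: ag.
by apply: (leq_trans iq); apply: (leq_trans (ltnW qb)); exact: (proj2 sbeta).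
Qed.

Lemma stopping0 : stopping (fun=> 0%N).
Proof. by []. Qed.

Lemma stopping_passages i : stopping (passages i).
Proof. elim: i => [|i IH]; [exact: stopping0|exact: stopping_passage]. Qed.

Lemma passages_le i N : (passages i N <= beta N)%N.
Proof. by case: i => [|i] //; exact: passage_le. Qed.

Lemma passages_mono N i j : (i <= j)%N -> (passages i N <= passages j N)%N.
Proof.
move=> /subnKC <-; elim: (j - i)%N => [|n IH]; first by rewrite addn0.
by rewrite addnS; apply: (leq_trans IH); apply: passage_ge; exact: passages_le.
Qed.

Lemma sum_block_passages N k :
  \sum_(i < k) block N (passages i N) (passages i.+1 N) = block N 0 (passages k N).
Proof.
elim: k => [|k IH]; first by rewrite big_ord0 /block big_geq.
by rewrite big_ord_recr IH [RHS](@block_cat _ _ (passages k N)) // passages_mono.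
Qed.

(** If [passages k N] were still below [beta N], each of the [k] successive blocks would have norm
    above [delta]. Divided by [C], they would form a block sequence as in property P with a sum of
    norm at most 1. *)
Lemma finitely_many_passages : property_P b -> 0 < delta ->
  exists k, forall N, incr N -> passages k N = beta N.
Proof.
move=> PP d0; have [C C0 hC] := block0_bounded.
have [k k0 hk] := PP (delta / C) (divr_gt0 d0 C0).
exists k => N hN; apply/eqP; rewrite eqn_leq passages_le leqNgt; apply/negP => lt.
pose x i : X := C^-1 *: block N (passages i N) (passages i.+1 N).
have suppx i j : (i < k)%N -> supp b (x i) j ->
    (mm (N (passages i N)) <= j < mm (N (passages i.+1 N)))%N.
  move=> ik; rewrite /supp /= schauder_coordZ // mulf_eq0 negb_or => /andP[_].
  by apply: block_supp => //; apply: (proj2 (stopping_passages _)).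
have : 1 < `|\sum_(i < k) x i|.
  apply: hk => i ik.
  - apply: (@sub_finite_set _ _ `I_(mm (N (passages i.+1 N)))); last exact: finite_II.
    by move=> j /(suppx _ _ ik) /andP[].
  - move=> m n /(suppx _ _ (ltnW ik)) /andP[_ h1] /(suppx _ _ ik) /andP[h2 _].
    exact: (leq_trans h1 h2).
  - rewrite /x normrZ gtr0_norm ?invr_gt0 // [leRHS]mulrC ler_pM2r ?invr_gt0 //.
    apply: ltW; apply: (proj2 (@passage_lt _ _ _)).
    by apply: (leq_ltn_trans _ lt); exact: (@passages_mono N i.+1 k).
rewrite -scaler_sumr sum_block_passages normrZ gtr0_norm ?invr_gt0 //.
rewrite ltNge mulrC ler_pdivrMr // mul1r hC //.
exact: (proj2 (stopping_passages _)).
Qed.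

End Passages.

Definition partial_sum (beta : (nat -> nat) -> nat) (N : nat -> nat) : X :=
  block N 0 (beta N).

Definition separated (alpha beta : (nat -> nat) -> nat) : Prop :=
  large [set N | (beta (sub 2 0 N) <= alpha (sub 2 1 N))%N].

Lemma separatedVlt alpha beta : stopping alpha -> stopping beta ->
  separated alpha beta \/
  large [set N | (alpha (sub 2 1 N) < beta (sub 2 0 N))%N].
Proof.
move=> sa sb'.
have l1 := local_sub (l := 2) 0 isT (stopping_local sb').
have l2 := local_sub (l := 2) 1 isT (stopping_local sa).
have [h|h] := tree_large_ultra (isT : sorted ltn [::])
  (local_map2 (fun m n : nat => (m <= n)%N : Prop) l1 l2); [by left|right].
by apply: tree_largeS h => N _ _ /= /negP; rewrite -ltnNge.
Qed.

(** The successor in [separated] is harmless: for a plegma pair the first block uses positions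
    [k < beta], the second [k' >= alpha], so [k <= k'], and at equal positions the element of the
    first member is already the smaller one. *)
Definition l1_block_between (alpha beta : (nat -> nat) -> nat) : Prop :=
  [/\ stopping alpha, stopping beta, forall N, incr N -> (alpha N <= beta N)%N,
      separated (fun N => (alpha N).+1) beta &
      exists2 c : R, 0 < c & lower (fun N => block N (alpha N) (beta N)) c].

Lemma l1_block_step beta (c : R) : property_P b -> stopping beta -> 0 < c ->
  lower (partial_sum beta) c ->
  (exists alpha, l1_block_between alpha beta) \/
  exists beta' (c' : R), [/\ stopping beta', 0 < c', lower (partial_sum beta') c' &
    large [set N | (beta' (sub 2 1 N) < beta (sub 2 0 N))%N]].
Proof.
move=> PP sbeta c0 lc.
(* The remainder of [lower_split] has constant [c / 2]; with threshold [c / 4] the portion discarded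
   from it leaves [c / 4]. *)
have c40 : 0 < c / 4 by rewrite divr_gt0.
have [k hk] := finitely_many_passages sbeta PP c40.
pose p i := passages (c / 4) beta i.
have sp i : stopping (p i) := stopping_passages (c / 4) sbeta i.
(* As [p 0] is zero, separation would force [beta] to vanish, and an empty sum contradicts the lower
   estimate. *)
have not0 : ~ separated (p 0%N) beta.
  move=> h0.
  have l1 := lc 1%N (fun=> 1) isT.
  have l2 := large_hereditary (incr_affine 0 (isT : (0 < 2)%N)) l1.
  have [N [hN _ [/= H1 H2]]] := tree_large_ex (isT : sorted ltn [::]) (tree_largeI h0 l2).
  move: H2; rewrite /comb !big_ord1 normr1 mulr1 scale1r.
  rewrite sub10 /partial_sum /block big_geq; last by move: H1; rewrite /p /= leqn0 => /eqP ->.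
  by rewrite normr0 leNgt c0.
(* If no index is separated, the dichotomy at [k], where [p k] equals [beta], says that [beta]
   itself decreases along plegma pairs; the iteration then restarts with [beta] unchanged. *)
case: (pselect (exists i, separated (p i) beta)) => [hex|nex]; last first.
  right; exists beta, c; split => //.
  have [h|] := separatedVlt (sp k) sbeta; first by case: nex; exists k.
  by apply: tree_largeS => N hN _ /=; rewrite /p hk //; apply: incr_sub.
have hex' : exists i, `[< separated (p i) beta >].
  by case: hex => i hi; exists i; apply/asboolP.
case: (ex_minnP hex') => -[|i] /asboolP hi hmin; first by case: not0.
have nsi : ~ separated (p i) beta.
  by move=> h; have := hmin i (introT (asboolP _) h); rewrite ltnn.
have [//|bad] := separatedVlt (sp i) sbeta.
have ple N : (p i N <= beta N)%N := passages_le (c / 4) beta i N.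
have lsum : lower (fun N => partial_sum (p i) N + block N (p i N) (beta N)) c.
  rewrite (_ : (fun N => _) = partial_sum beta) //; apply/funext => N.
  by rewrite /partial_sum -block_cat // ple.
have loc1 : local (partial_sum (p i)).
  exact: (determined_local (determined_block stopping0 (sp i))).
have loc2 := determined_local (determined_block (sp i) sbeta).
have [[c' c'0 hc']|lr] := lower_split c0 loc1 loc2 lsum.
  by right; exists (p i), c'; split.
(* [passage_before] bounds only blocks ending strictly before the next passage, hence the
   predecessor; the maximum covers the case where [p i.+1] does not move. *)
left; exists (fun N => maxn (p i N) (p i.+1 N).-1); split => //.
- split=> [N N' hN hN' ag|N hN].
    by rewrite ((proj1 (sp i)) _ _ hN hN' ag) ((proj1 (sp i.+1)) _ _ hN hN' ag).
  rewrite geq_max (proj2 (sp i)) //=.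
  exact: (leq_trans (leq_pred _) (proj2 (sp i.+1) _ hN)).
- move=> N hN; rewrite geq_max ple /=.
  exact: (leq_trans (leq_pred _) (passages_le (c / 4) beta i.+1 N)).
- apply: tree_largeS hi => N hN _ /= h; apply: (leq_trans h).
  by apply: (leq_trans (leqSpred _)); rewrite ltnS leq_maxr.
- exists (c / 2 - c / 4); first by lra.
  apply: lower_perturb lr => N hN.
  set al := maxn _ _.
  have h1 : (p i N <= al)%N by rewrite leq_maxl.
  have h2 : (al <= beta N)%N.
    by rewrite geq_max ple (leq_trans (leq_pred _)) //; exact: (passages_le _ _ i.+1).
  rewrite (@block_cat _ _ al _) ?h1 ?h2 // addrK.
  case: (leqP (p i.+1 N).-1 (p i N)) => h3.
    by rewrite /al (maxn_idPl h3) /block big_geq ?normr0 ?ltW.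
  have e : al = (p i.+1 N).-1 by rewrite /al (maxn_idPr (ltnW h3)).
  apply: (@passage_before (c / 4) beta (p i)) => //; first exact: ltW.
  rewrite e -[X in (_ < X)%N]/(p i.+1 N) prednK //; by case: (p i.+1 N) h3.
Qed.

(* Otherwise [l1_block_step] can be iterated forever, and evaluating the
   successive stopping times along the chain of plegma pairs
   [k |-> L (j + 2 k)] would give a strictly decreasing sequence in [nat]. *)
Lemma l1_block_exists (c : R) : property_P b -> 0 < c ->
  lower (partial_sum tau) c -> exists alpha beta, l1_block_between alpha beta.
Proof.
move=> PP c0 lc; apply: contrapT => hn.
(* The constant is existentially quantified because it may deteriorate at each step. *)
pose good beta := stopping beta /\ exists2 c : R, 0 < c & lower (partial_sum beta) c.
have /choice[next hnext] : forall s : {beta | good beta}, exists s' : {beta | good beta},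
    large [set N | (sval s' (sub 2 1 N) < sval s (sub 2 0 N))%N].
  move=> [beta [sbeta [c1 c10 l1]]].
  have [[alpha h]|] := l1_block_step PP sbeta c10 l1; first by case: hn; exists alpha, beta.
  move=> [beta' [c' [s' c'0 l' h']]].
  by exists (exist _ beta' (conj s' (ex_intro2 _ _ c' c'0 l'))).
have gtau : good tau by split; [split|exists c].
pose bt i := sval (iter i next (exist _ tau gtau)).
have [L hL hQ] := large_diag (fun i => hnext (iter i next (exist _ tau gtau))).
have desc i : (bt i.+1 (fun k => L (i.+1 + 2 * k)) < bt i (fun k => L (i + 2 * k)))%N.
  have hi : incr (fun k => i + k)%N by move=> x y xy; rewrite ltn_add2l.
  (* The shift by [i] meets the condition [i <= N 0], and makes the second member of the pair at
     stage [i] the first member at stage [i.+1]. *)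
  have := hQ i (fun k => i + k)%N hi (leq_addr _ _).
  have e0 : sub 2 0 (L \o (fun k => i + k)%N) = fun k => L (i + 2 * k)%N.
    by apply/funext => k; rewrite /sub /= addn0.
  have e1 : sub 2 1 (L \o (fun k => i + k)%N) = fun k => L (i.+1 + 2 * k)%N.
    by apply/funext => k; rewrite /sub /= addnCA addn1 addSn addnS -addnS addnCA; congr (L _); lia.
  by rewrite /= e0 e1.
have dd i : (bt i (fun k => L (i + 2 * k)) + i <= bt 0 (fun k => L (0 + 2 * k)))%N.
  elim: i => [|i IH]; first by rewrite addn0.
  by apply: leq_trans IH; rewrite addnS -addSn leq_add2r.
have := dd (bt 0 (fun k => L (0 + 2 * k))).+1.
by rewrite addnS ltnNge leq_addl.
Qed.

End Core.

(** * From large sets to spreading models *)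

Definition fset_of (s : seq nat) : {fset nat} := [fset x in s]%fset.

Lemma sort_leq_sorted (s : {fset nat}) : sorted ltn (sort leq s).
Proof.
by rewrite ltn_sorted_uniq_leq sort_uniq fset_uniq sort_sorted //; exact: leq_total.
Qed.

Lemma sort_fset_of (s : seq nat) : sorted ltn s -> sort leq (fset_of s) = s.
Proof.
move=> ss; apply: (irr_sorted_eq ltn_trans ltnn) => //; first exact: sort_leq_sorted.
by move=> x; rewrite mem_sort /fset_of in_fset /=.
Qed.

Lemma fset_of_sort (s : {fset nat}) : fset_of (sort leq s) = s.
Proof. by apply/fsetP => x; rewrite /fset_of in_fset /= mem_sort. Qed.

Lemma size_sort_card (s : {fset nat}) : size (sort leq s) = #|` s|.
Proof. by rewrite size_sort. Qed.

Lemma card_fset_of (s : seq nat) : sorted ltn s -> #|` fset_of s| = size s.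
Proof. by move=> ss; rewrite -size_sort_card sort_fset_of. Qed.

Lemma elt_fset_of (s : seq nat) k : sorted ltn s -> elt (fset_of s) k = nth 0%N s k.
Proof. by move=> ss; rewrite /elt sort_fset_of. Qed.

Definition segment (S : nat -> nat) (k : nat) : {fset nat} := fset_of (mkseq S k).

Lemma card_segment S k : incr S -> #|` segment S k| = k.
Proof. by move=> hS; rewrite card_fset_of ?size_mkseq //; exact: incr_mkseq_sorted. Qed.

Lemma elt_segment S k i : incr S -> (i < k)%N -> elt (segment S k) i = S i.
Proof. by move=> hS ik; rewrite elt_fset_of ?nth_mkseq //; exact: incr_mkseq_sorted. Qed.

Lemma segment_elt (s : {fset nat}) (S : nat -> nat) :
  (forall i, (i < #|` s|)%N -> S i = elt s i) -> segment S #|` s| = s.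
Proof.
move=> h; rewrite -[RHS]fset_of_sort /segment; congr fset_of.
apply: (@eq_from_nth _ 0%N); rewrite size_mkseq ?size_sort_card // => i hi.
by rewrite nth_mkseq // h.
Qed.

Lemma initial_segment_segment S k k' : incr S -> (k <= k')%N ->
  initial_segment (segment S k) (segment S k').
Proof.
move=> hS kk; rewrite /initial_segment /segment !sort_fset_of; try exact: incr_mkseq_sorted.
by rewrite -(subnKC kk) /mkseq iotaD map_cat prefix_prefix.
Qed.

Lemma thin_segment (F : set {fset nat}) S k k' : thin F -> incr S ->
  F (segment S k) -> F (segment S k') -> k = k'.
Proof.
move=> tF hS; wlog kk : k k' / (k <= k')%N => [hw h h'|h h'].
  by case: (leqP k k') => [|/ltnW] kk; [exact: hw|symmetry; exact: hw].
have := tF _ _ h' h (initial_segment_segment hS kk).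
by move/(congr1 (fun s : {fset nat} => #|` s|)); rewrite !card_segment.
Qed.

Lemma thin_neq0 (F : set {fset nat}) s s0 : thin F -> F s0 -> s0 != fset0 ->
  F s -> s != fset0.
Proof.
move=> tF Fs0 s00 Fs; apply/negP => /eqP e.
have := tF _ _ Fs0 Fs; rewrite e /initial_segment.
have -> : sort leq fset0 = [::] by apply: size0nil; rewrite size_sort_card cardfs0.
by rewrite prefix0s => /(_ isT) e'; rewrite -e' eqxx in s00.
Qed.

Lemma incr_increasing_seq (S : nat -> nat) : incr S -> increasing_seq S.
Proof. by move=> hS m n; rewrite leEnat; exact: incr_mono. Qed.

(* Positions are read modulo [k] as [k] interlaced finite sequences; the gaps
   of size [k] between pinned values leave room for the missing terms. *)
Lemma pinned_extend (pin : pred nat) (w : nat -> nat) (k : nat) : (0 < k)%N ->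
  pin 0%N -> (forall n, pin n -> (k <= n)%N -> pin (n - k)%N) ->
  (forall m n, pin m -> pin n -> (m < n <= m + k)%N -> (w m + k <= w n)%N) ->
  exists2 N, incr N & forall n, pin n -> N n = w n.
Proof.
move=> k0 p0 hsub hw.
have ex n : forall m, pin m -> pin n -> (m < n)%N -> (w m + (n - m) <= w n)%N.
  elim/ltn_ind: n => n IH m pm pn mn.
  case: (leqP n (m + k)) => h.
    by apply: leq_trans (hw _ _ pm pn _); [rewrite leq_add2l; lia|rewrite mn].
  have kn : (k <= n)%N by lia.
  have pnk := hsub _ pn kn.
  have h1 : (w m + (n - k - m) <= w (n - k))%N by apply: IH => //; lia.
  have h2 : (w (n - k) + k <= w n)%N by apply: hw => //; lia.
  lia.
(* This grows by at least one per step from each pinned value; the spacing of the pins, recorded in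
   [ex], makes it take the prescribed value at each of them. *)
pose N n := \max_(m < n.+1 | pin m) (w m + (n - m))%N.
have Nge n m : (m <= n)%N -> pin m -> (w m + (n - m) <= N n)%N.
  by move=> mn pm; exact: (@leq_bigmax_cond _ (fun i : 'I_n.+1 => pin i)
    (fun i => w i + (n - i))%N (Ordinal (mn : (m < n.+1)%N))).
have Nle n B : (forall m, (m <= n)%N -> pin m -> (w m + (n - m) <= B)%N) -> (N n <= B)%N.
  by move=> h; apply/bigmax_leqP => i pi; apply: h => //; rewrite -ltnS.
exists N.
  apply: incrS => n.
  have : (0 < N n.+1)%N by apply: leq_trans (Nge n.+1 0%N _ p0) => //; lia.
  move=> pos; rewrite -(prednK pos) ltnS; apply: Nle => m mn pm.
  have := Nge n.+1 m (leqW mn) pm; lia.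
move=> n pn; apply/eqP; rewrite eqn_leq; apply/andP; split; last first.
  by have := Nge n n (leqnn _) pn; rewrite subnn addn0.
apply: Nle => m; rewrite leq_eqVlt => /orP[/eqP ->|mn] pm; first by rewrite subnn addn0.
exact: ex.
Qed.

(** For [i >= l] the squares of [i.+1] and [i.+2] differ by [2 * i + 3], which is at least [l + 2]
    and so at least the size of the tuple: this is the gap required by [pinned_extend]. The bound
    [l.+2], one more than spreading models need, admits plegma pairs at [l = 0]. *)
Lemma plegma_extend (ss : seq {fset nat}) (G : nat -> nat) (l : nat) :
  incr G -> (0 < size ss <= l.+2)%N -> plegma ss ->
  (forall j t, (j < size ss)%N -> (t < #|` nth fset0 ss j|)%N ->
    exists2 i, (l <= i)%N & G (i.+1 ^ 2)%N = elt (nth fset0 ss j) t) ->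
  exists N, [/\ incr N, (l <= N 0)%N & forall j t, (j < size ss)%N ->
    (t < #|` nth fset0 ss j|)%N ->
    G (sub (size ss) j N t) = elt (nth fset0 ss j) t].
Proof.
move=> hG; set k := size ss => /andP[k0 kl] [pl1 pl2 pl3] hidx.
pose el n := elt (nth fset0 ss (n %% k)) (n %/ k).
pose pin n := (n %/ k < #|` nth fset0 ss (n %% k)|)%N.
have /choice[ix hix] : forall n, exists i, pin n -> (l <= i)%N /\ G (i.+1 ^ 2)%N = el n.
  move=> n; case: (boolP (pin n)) => pn; last by exists 0%N.
  by have [i h1 h2] := hidx (n %% k)%N (n %/ k)%N (ltn_pmod _ k0) pn; exists i.
have pos j : (j < k)%N -> (0 < #|` nth fset0 ss j|)%N.
  by move=> jk; rewrite cardfs_gt0; apply: pl1.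
have [] := @pinned_extend pin (fun n => (ix n).+1 ^ 2)%N k k0.
- by rewrite /pin mod0n div0n pos.
- move=> n pn kn; rewrite /pin.
  have e : n = ((n - k) + k)%N by rewrite subnK.
  move: pn; rewrite /pin {1 2}e divnDr // divnn k0 modnDr => /(leq_ltn_trans _); apply.
  exact: leq_addr.
- move=> m n pm pn /andP[mn nmk].
  have [lm em] := hix m pm; have [ln en] := hix n pn.
  suff lt : (ix m < ix n)%N.
    have : ((ix m).+2 ^ 2 <= (ix n).+1 ^ 2)%N by rewrite leq_exp2r.
    rewrite -!mulnn; nia.
  have : (el m < el n)%N.
    have jm := ltn_pmod m k0; have jn := ltn_pmod n k0.
    have dm := divn_eq m k; have dn := divn_eq n k.
    have pm' := pm; have pn' := pn; rewrite /pin in pm' pn'.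
    (* Since [n <= m + k], either [n] is in the next row, governed by the second plegma inequality,
       or in the same row, governed by the first. *)
    case: (ltngtP (m %/ k) (n %/ k)) => hd.
    + have ed : (n %/ k = (m %/ k).+1)%N by nia.
      rewrite /el ed; apply: pl3 => //; rewrite leq_min pm' /=.
      by rewrite ltn_predRL; move: pn'; rewrite ed.
    + by nia.
    + rewrite /el -hd; apply: pl2; first by rewrite jn andbT; lia.
      by rewrite leq_min pm' /= hd.
  rewrite -em -en (incr_mono_ltn hG) ltn_exp2r //.
move=> N hN hpin; exists N; split => //.
  have p0 : pin 0%N by rewrite /pin mod0n div0n pos.
  rewrite (hpin _ p0); have [h _] := hix _ p0.
  by apply: (leq_trans h); rewrite -mulnn; lia.
move=> j t jk ht.
have e1 : ((k * t + j) %/ k = t)%N by rewrite mulnC divnMDl // divn_small // addn0.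
have e2 : ((k * t + j) %% k = j)%N by rewrite mulnC modnMDl modn_small.
have pt : pin (k * t + j)%N by rewrite /pin e1 e2.
by rewrite /sub (hpin _ pt) (proj2 (hix _ pt)) /el e1 e2.
Qed.

(** The limit is the supremum of the [t] that are lower bounds of [g] on a large set; the dichotomy
    turns the failure of a lower bound into a large upper bound. *)
Lemma large_limit (R : realType) (g : (nat -> nat) -> R) (B : R) : local g ->
  (forall N, incr N -> `|g N| <= B) ->
  exists y : R, forall e, 0 < e -> large [set N | `|g N - y| <= e].
Proof.
move=> lg hB; pose S := [set t : R | large [set N | t <= g N]].
have S0 : S !=set0.
  exists (- B); apply: tree_largeT => N hN _ /=.
  by have := hB N hN; rewrite ler_norml => /andP[].
have SB : ubound S B.
  move=> t /(tree_large_ex (isT : sorted ltn [::])) [N [hN _ /= h]].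
  by apply: (le_trans h); apply: (le_trans (ler_norm _)); exact: hB.
have hS : has_sup S by split => //; exists B.
exists (sup S) => e e0.
have [t St ht] := sup_adherent e0 hS.
have h2 : large [set N | g N < sup S + e].
  have lQ := local_map (fun x : R => sup S + e <= x : Prop) lg.
  have [h|] := tree_large_ultra (isT : sorted ltn [::]) lQ.
    by have := sup_upper_bound hS h; rewrite gerDl leNgt e0.
  by apply: tree_largeS => N _ _ /= /negP; rewrite -ltNge.
apply: tree_largeS (tree_largeI St h2) => N _ _ [/= h1 h3].
rewrite ler_distl; apply/andP; split; last exact: ltW.
exact: (le_trans (ltW ht) h1).
Qed.

(** * The limit norm and its l^1 estimates *)

Section SpreadingModel.
Variables (R : realType) (X : normedModType R) (z : (nat -> nat) -> X) (K c : R).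
Hypotheses (zK : forall N, incr N -> `|z N| <= K) (lz : local z).
Hypotheses (c0 : 0 < c) (low : lower z c).

Lemma comb_bound (a : nat -> R) n N : (0 < n)%N -> incr N ->
  `|comb z a n N| <= K * \sum_(j < n) `|a j|.
Proof.
move=> n0 hN; apply: (le_trans (ler_norm_sum _ _ _)); rewrite mulr_sumr.
by apply: ler_sum => j _; rewrite normrZ mulrC ler_wpM2r // zK //; exact: incr_sub.
Qed.

Lemma comb_lin (s : R) (a d : nat -> R) n N :
  comb z (fun j => s * a j + d j) n N = s *: comb z a n N + comb z d n N.
Proof.
rewrite /comb scaler_sumr -big_split /=; apply: eq_bigr => j _.
by rewrite scalerDl scalerA.
Qed.

Lemma comb_eq (a d : nat -> R) n N : (forall j, (j < n)%N -> a j = d j) ->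
  comb z a n N = comb z d n N.
Proof. by move=> h; apply: eq_bigr => j _; rewrite h. Qed.

(** Polynomials serve as the finitely supported coefficient sequences. Any length [n >= size q]
    gives the same limit, since the extra coefficients vanish and the first members of a longer
    interlaced tuple may be selected. *)
Lemma limit_norm_exists : exists p : {poly R} -> R, forall (q : {poly R}) n (e : R), (0 < n)%N ->
  (size q <= n)%N -> 0 < e ->
  large [set N | `| `|comb z (fun j => q`_j) n N| - p q| <= e].
Proof.
(* The length [(size q).-1.+1] stays positive for the zero polynomial, where [sub 0] would be
   degenerate. *)
have /choice[p hp] : forall q : {poly R}, exists y : R, forall e, 0 < e ->
    large [set N | `| `|comb z (fun j => q`_j) (size q).-1.+1 N| - y| <= e].
  move=> q; apply: (@large_limit _ _ (K * \sum_(j < (size q).-1.+1) `|q`_j|)).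
    exact: (local_map (fun x : X => `|x|) (local_comb _ _ lz)).
  by move=> N hN; rewrite normr_id comb_bound.
exists p => q n e n0 qn e0; set m := (size q).-1.+1.
have mn : (m <= n)%N by rewrite /m; case: (size q) qn.
have := @large_comb_select _ _ (fun x => `| `|x| - p q| <= e) z (fun j => q`_j)
  m n id isT _ _ (hp q e e0).
move=> /(_ _ _)[]; [by move=> i j /andP[]|by move=> i /leq_trans; apply|].
move=> A hA hQ; exists A => // N h1 h2 h3; have /= := hQ N h1 h2 h3.
rewrite /comb -(big_mkord xpredT (fun j => q`_j *: z (sub n j N))) => H.
rewrite -(big_mkord xpredT (fun j => q`_j *: z (sub n j N))).
rewrite [\sum_(0 <= j < n) _](_ : _ = \sum_(0 <= j < m) q`_j *: z (sub n j N)) //.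
rewrite (big_cat_nat _ (n := m)) //= [X in _ + X]big_nat_cond.
rewrite [X in _ + X]big1 ?addr0 // => j /andP[/andP[mj _] _].
by rewrite nth_default ?scale0r //; apply: leq_trans mj; rewrite /m; case: (size q).
Qed.

Variable p : {poly R} -> R.
Hypothesis hp : forall (q : {poly R}) n (e : R), (0 < n)%N -> (size q <= n)%N -> 0 < e ->
  large [set N | `| `|comb z (fun j => q`_j) n N| - p q| <= e].

Lemma limit_norm_seminorm : seminorm (p : {poly R} -> R).
Proof.
split=> [q|q q'|s q].
- apply/ler_addgt0Pr => e e0.
  have [N [hN _ /=]] := tree_large_ex (isT : sorted ltn [::]) (hp (ltn0Sn (size q)) (leqnSn _) e0).
  rewrite ler_distl => /andP[_ h]; have := normr_ge0 (comb z (fun j => q`_j) (size q).+1 N).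
  by move=> h'; apply: (le_trans h'); apply: (le_trans h).
- apply/ler_addgt0Pr => e e0; have e30 : 0 < e / 3 by rewrite divr_gt0.
  pose n := (maxn (size q) (size q')).+1.
  have n1 : (size q <= n)%N by rewrite leqW // leq_maxl.
  have n2 : (size q' <= n)%N by rewrite leqW // leq_maxr.
  have n3 : (size (q + q')%R <= n)%N by apply: (leq_trans (size_polyD _ _)).
  have [N [hN _ [/= h1 [h2 h3]]]] := tree_large_ex (isT : sorted ltn [::])
    (tree_largeI (hp (ltn0Sn _) n1 e30) (tree_largeI (hp (ltn0Sn _) n2 e30) (hp (ltn0Sn _) n3 e30))).
  have e1 : comb z (fun j => (q + q')`_j) n N =
      comb z (fun j => q`_j) n N + comb z (fun j => q'`_j) n N.
    rewrite -[comb z (fun j => q`_j) n N]scale1r -comb_lin; apply: comb_eq => j _.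
    by rewrite coefD mul1r.
  rewrite e1 in h3.
  have := ler_normD (comb z (fun j => q`_j) n N) (comb z (fun j => q'`_j) n N).
  move: h1 h2 h3; rewrite !ler_distl => /andP[? ?] /andP[? ?] /andP[? ?] ?; lra.
- apply/eqP; rewrite -subr_eq0 -normr_le0; apply/ler_addgt0Pr => e e0.
  have s0 : 0 < 1 + `|s| by rewrite ltr_pwDl.
  have e10 : 0 < e / (1 + `|s|) by rewrite divr_gt0.
  have n2 : (size (s *: q) <= (size q).+1)%N by rewrite (leq_trans (size_scale_leq _ _)).
  have H1 := hp (ltn0Sn (size q)) (leqnSn _) e10.
  have H2 := hp (ltn0Sn (size q)) n2 e10.
  have [N [hN _ [/= h1 h2]]] := tree_large_ex (isT : sorted ltn [::]) (tree_largeI H1 H2).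
  have e1 : comb z (fun j => (s *: q)`_j) (size q).+1 N = s *: comb z (fun j => q`_j) (size q).+1 N.
    by rewrite /comb scaler_sumr; apply: eq_bigr => j _; rewrite coefZ scalerA.
  rewrite e1 normrZ in h2; set y := `|comb _ _ _ _| in h1 h2.
  have -> : p (s *: q) - `|s| * p q = - (`|s| * y - p (s *: q)) + `|s| * (y - p q).
    by rewrite mulrBr opprB addrA subrK.
  rewrite add0r; apply: (le_trans (ler_normD _ _)); rewrite normrN normrM normr_id.
  have h3 : `|s| * `|y - p q| <= `|s| * (e / (1 + `|s|)) by rewrite ler_wpM2l.
  apply: (le_trans (lerD h2 h3)).
  by rewrite -{1}[_ / _]mul1r -mulrDl mulrC divfK // gt_eqF.
Qed.

Lemma poly_hamel_basis : hamel_basis (fun n => 'X^n : {poly R}).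
Proof.
split=> [n a h j jn|q].
  have := congr1 (fun q : {poly R} => q`_j) h.
  by rewrite -poly_def coef_poly jn coef0.
by exists (size q), (fun j => q`_j); rewrite -poly_def coefK.
Qed.

Lemma large_sum_Xn (a : nat -> R) n (e : R) : (0 < n)%N -> 0 < e ->
  large [set N | `| `|comb z a n N| - p (\sum_(j < n) a j *: 'X^j)| <= e].
Proof.
move=> n0 e0; rewrite -poly_def.
have := hp n0 (size_poly n a) e0; apply: tree_largeS => N hN _ /=.
by rewrite (@comb_eq _ a) // => j jn; rewrite coef_poly jn.
Qed.

Lemma limit_norm_l1 : equivalent_to_l1_basis p (fun n => 'X^n : {poly R}).
Proof.
have K0 : 0 <= K.
  have hid : incr id by [].
  exact: le_trans (zK hid).
(* Only [0 <= K] has been established, while the upper constant has to be positive. *)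
exists c, (K + 1); split=> [//||n a]; first by rewrite ltr_wpDl.
case: n => [|n].
  rewrite !big_ord0 !mulr0.
  by have [_ _ h] := limit_norm_seminorm; have := h 0 0; rewrite scale0r normr0 mul0r => ->.
have A0 : 0 <= \sum_(j < n.+1) `|a j| by apply: sumr_ge0.
split; apply/ler_addgt0Pr => e e0.
- have [N [hN _ [/= h1 h2]]] := tree_large_ex (isT : sorted ltn [::])
    (tree_largeI (low a (ltn0Sn n)) (large_sum_Xn a (ltn0Sn n) e0)).
  by move: h2; rewrite ler_distl => /andP[_ h2]; exact: le_trans h2.
- have [N [hN _ /= h2]] := tree_large_ex (isT : sorted ltn [::]) (large_sum_Xn a (ltn0Sn n) e0).
  have h1 := comb_bound a (ltn0Sn n) hN.
  move: h2; rewrite ler_distl => /andP[h2 _]; rewrite mulrDl mul1r.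
  rewrite -lerBlDr in h2 *; lra.
Qed.

Lemma limit_norm_lip (a d : nat -> R) n (e : R) : (0 < n)%N ->
  (forall j, (j < n)%N -> `|a j - d j| <= e) ->
  (forall N, incr N -> `| `|comb z a n N| - `|comb z d n N| | <= K * (e *+ n)) /\
  `|p (\sum_(j < n) a j *: 'X^j) - p (\sum_(j < n) d j *: 'X^j)| <= K * (e *+ n).
Proof.
move=> n0 h.
have K0 : 0 <= K.
  have hid : incr id by [].
  exact: le_trans (zK hid).
have H N : incr N -> `| `|comb z a n N| - `|comb z d n N| | <= K * (e *+ n).
  move=> hN; apply: (le_trans (ler_dist_dist _ _)).
  have -> : comb z a n N - comb z d n N = comb z (fun j => a j - d j) n N.
    by rewrite /comb -sumrB; apply: eq_bigr => j _; rewrite scalerBl.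
  apply: (le_trans (comb_bound _ n0 hN)); apply: ler_wpM2l => //.
  rewrite -[X in _ <= _ *+ X]card_ord -sumr_const; apply: ler_sum => j _; exact: h.
split=> //; apply/ler_addgt0Pr => r r0; have r20 : 0 < r / 2 by rewrite divr_gt0.
have [N [hN _ [/= h1 h2]]] := tree_large_ex (isT : sorted ltn [::])
  (tree_largeI (large_sum_Xn a n0 r20) (large_sum_Xn d n0 r20)).
move: h1 h2 (H N hN); rewrite !ler_distl => /andP[? ?] /andP[? ?] /andP[? ?].
by apply/andP; split; lra.
Qed.

(* Coefficients are discretised to the grid of mesh [1/m] to make the
   approximation uniform over [[-1,1]^n]. *)
Lemma large_uniform n (e : R) : (0 < n)%N -> 0 < e ->
  large [set N | forall a : nat -> R, (forall j, (j < n)%N -> -1 <= a j <= 1) ->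
    `| `|comb z a n N| - p (\sum_(j < n) a j *: 'X^j)| <= e].
Proof.
move=> n0 e0; have e30 : 0 < e / 3 by rewrite divr_gt0.
have K0 : 0 <= K.
  have hid : incr id by [].
  exact: le_trans (zK hid).
(* The mesh is chosen so that replacing [a] by a grid point changes the norm, and the limit norm, by
   at most [e / 3] each; the points [i / m - 1] with [i <= 2 * m] cover [[-1, 1]]. *)
pose m := (Num.truncn (K *+ n / (e / 3))).+1.
have m0 : 0 < m%:R :> R by rewrite ltr0n.
have hm : K * (m%:R^-1 *+ n) <= e / 3.
  have /ltW : K *+ n / (e / 3) < m%:R := truncnS_gt _.
  rewrite ler_pdivrMr // => h.
  by rewrite mulrnAr -mulrnAl ler_pdivrMr // mulrC.
pose gr (t : {ffun 'I_n -> 'I_(2 * m).+1}) (j : nat) : R :=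
  if insub j is Some i then (t i)%:R / m%:R - 1 else 0.
have := tree_large_all (fun t => large_sum_Xn (gr t) n0 e30).
apply: tree_largeS => N hN _ /= hall a ha.
pose t : {ffun 'I_n -> 'I_(2 * m).+1} :=
  [ffun i : 'I_n => inord (Num.truncn ((a i + 1) * m%:R))].
have ht j : (j < n)%N -> `|a j - gr t j| <= m%:R^-1.
  move=> jn; rewrite /gr insubT /= ffunE /=.
  have /andP[a1 a2] := ha j jn.
  have p0 : 0 <= (a j + 1) * m%:R by rewrite mulr_ge0 // -lerBlDr sub0r.
  have /andP[t1 t2] := truncn_itv p0.
  rewrite inordK; last first.
    rewrite ltnS -(ler_nat R); apply: (le_trans t1).
    by rewrite natrM ler_pM2r //; lra.
  set T := Num.truncn _ in t1 t2 *.
  rewrite ler_distl; apply/andP; split.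
  - have h1 : T%:R / m%:R <= a j + 1 by rewrite ler_pdivrMr.
    have h2 : 0 <= m%:R^-1 :> R by rewrite invr_ge0 ltW.
    lra.
  - have : a j + 1 <= T.+1%:R / m%:R by rewrite ler_pdivlMr // ltW.
    by rewrite -natr1 mulrDl mul1r; lra.
have [H1 H2] := limit_norm_lip n0 ht.
have := hall t; move: (H1 N hN) H2; rewrite !ler_distl => /andP[? ?] /andP[? ?] /andP[? ?].
by apply/andP; split; lra.
Qed.

End SpreadingModel.

(** Large properties only concern interlaced sequences taken from one branch. Restricting to a
    sparse set [M] makes every plegma tuple in it the tuple of prefixes of such sequences, so that
    they become statements about all plegma tuples. *)
Lemma admits_l1_plegma_block_of_lower (R : realType) (X : normedModType R)
    (b : nat -> X) (F : set {fset nat}) (H : nat -> nat)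
    (tau : (nat -> nat) -> nat) (z : (nat -> nat) -> X) (K c : R) :
  regular_thin F -> incr H ->
  (forall N, incr N -> F (segment (H \o N) (tau N))) ->
  determined tau z -> (forall N, incr N -> `|z N| <= K) ->
  0 < c -> lower z c ->
  (forall N, incr N -> finite_set (supp b (z N))) ->
  large [set N | set_lt (supp b (z (sub 2 0 N))) (supp b (z (sub 2 1 N)))] ->
  admits_l1_plegma_block b.
Proof.
move=> rF hH Ftau dz zK c0 low fz bz.
have [tF _ _] := rF.
have lz := determined_local dz.
have [p hp] := limit_norm_exists zK lz.
pose Q l := [set N | (forall n : 'I_l.+1, forall a : nat -> R,
     (forall j, (j < n.+1)%N -> -1 <= a j <= 1) ->
     `| `|comb z a n.+1 N| - p (\sum_(j < n.+1) a j *: 'X^j)| <= l.+1%:R^-1) /\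
     set_lt (supp b (z (sub 2 0 N))) (supp b (z (sub 2 1 N)))].
have hQ l : large (Q l).
  apply: tree_largeI => //; apply: tree_large_all => n.
  by apply: (large_uniform zK hp) => //; rewrite invr_gt0 ltr0n.
have [L hL hLQ] := large_diag hQ.
pose G := H \o L; have hG : incr G := incr_comp hH hL.
pose M i := G (i.+1 ^ 2)%N.
have hM : incr M.
  by move=> i j ij; apply: hG; rewrite ltn_exp2r.
(* A set may be the prefix of many branches; the choice of a representative is immaterial, because
   [z] depends only on the prefix of length [tau], and that length is the cardinality of the set. *)
pose rep s := [set N | incr N /\ segment (H \o N) (tau N) = s].
have /choice[rp hrp] : forall s, exists N : nat -> nat, (exists N', rep s N') -> rep s N.
  move=> s; case: (pselect (exists N', rep s N')) => [[N' hN']|h]; first by exists N'.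
  by exists id.
pose x s : X := z (rp s).
have xz N : incr N -> x (segment (H \o N) (tau N)) = z N.
  move=> hN; have rN : rep (segment (H \o N) (tau N)) N by [].
  have [hN' e] := hrp _ (ex_intro _ N rN).
  rewrite /x; set N' := rp _ in hN' e *.
  have et : tau N' = tau N.
    have := congr1 (fun s : {fset nat} => #|` s|) e.
    by rewrite /= !card_segment //; exact: incr_comp.
  apply: dz => // i iN; apply: (incr_inj hH).
  have := congr1 (elt^~ i) e.
  by rewrite /= (elt_segment (incr_comp hH hN') iN) (elt_segment (incr_comp hH hN)) // -et.
have key l ss : (0 < size ss <= l.+2)%N ->
    (forall s, s \in ss -> restrict_family F M s) -> plegma ss ->
    (M l <= elt (nth fset0 ss 0) 0)%N ->
    exists N, [/\ incr N, (l <= N 0)%N & forall j, (j < size ss)%N ->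
      x (nth fset0 ss j) = z (sub (size ss) j (L \o N))].
  move=> ssl ssF pl Ml; have [s0 ss0] := andP ssl.
  have pl' := pl; case: pl' => [pl1 pl2 pl3].
  have hpos j : (j < size ss)%N -> (0 < #|` nth fset0 ss j|)%N.
    by move=> jk; rewrite cardfs_gt0; apply: pl1.
  have M0 j t : (j < size ss)%N -> (t < #|` nth fset0 ss j|)%N ->
      (M l <= elt (nth fset0 ss j) t)%N.
    move=> js ts; apply: (leq_trans Ml).
    have h1 : (elt (nth fset0 ss 0) 0 <= elt (nth fset0 ss j) 0)%N.
      case: j js {ts} => [//|j] js; apply: ltnW; apply: pl2; first by rewrite js.
      by rewrite leq_min !hpos.
    apply: (leq_trans h1); case: t ts => [//|t ts]; apply: ltnW.
    have := @sorted_ltn_nth _ _ ltn_trans 0%N _ (sort_leq_sorted (nth fset0 ss j)) 0 t.+1.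
    by rewrite !inE !size_sort_card => /(_ (hpos j js) ts isT).
  have hidx j t : (j < size ss)%N -> (t < #|` nth fset0 ss j|)%N ->
      exists2 i, (l <= i)%N & G (i.+1 ^ 2)%N = elt (nth fset0 ss j) t.
    move=> js ts; have [_ sM] := ssF _ (mem_nth fset0 js).
    have : [set` nth fset0 ss j] (elt (nth fset0 ss j) t).
      by rewrite /= -(mem_sort leq) /elt mem_nth // size_sort_card.
    move=> /sM [i _ hi]; exists i => //.
    by have := M0 j t js ts; rewrite -hi incr_mono.
  have [N [hN lN hNe]] := plegma_extend hG ssl pl hidx.
  exists N; split => // j js; have [Fs _] := ssF _ (mem_nth fset0 js).
  have hS : incr (sub (size ss) j (L \o N)) by apply: incr_sub => //; exact: incr_comp.
  have e1 : segment (H \o sub (size ss) j (L \o N)) #|` nth fset0 ss j| = nth fset0 ss j.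
    by apply: segment_elt => i hi; rewrite -(hNe j i).
  (* Both the given set and the prefix selected by [tau] lie in [F] and on one branch; thinness
     makes them equal. *)
  have e2 : #|` nth fset0 ss j| = tau (sub (size ss) j (L \o N)).
    apply: (thin_segment tF (incr_comp hH hS)); first by rewrite e1.
    exact: Ftau.
  by rewrite -{1}e1 e2 xz.
have xz1 s : restrict_family F M s -> exists2 N, incr N & x s = z N.
  move=> Fs; have sn0 : s != fset0.
    by have [_ _ [s0 Fs0 s00]] := rF; exact: (thin_neq0 tF Fs0 s00 (proj1 Fs)).
  have pl : plegma [:: s].
    split=> [[|i]//|i j k|[|i] [|j] k] //=; first by case: j => [|j] /andP[].
    move=> _ _; rewrite leq_min => /andP[k1 k2].
    have := @sorted_ltn_nth _ _ ltn_trans 0%N _ (sort_leq_sorted s) k k.+1.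
    by rewrite !inE !size_sort_card k1 -ltn_predRL k2 => /(_ isT isT (ltnSn k)).
  have [||N [hN _ /(_ 0%N isT) /= e]] := key 0%N [:: s] isT _ pl.
  - by move=> s'; rewrite inE => /eqP ->.
  - have : [set` s] (elt s 0).
      by rewrite /= -(mem_sort leq) /elt mem_nth // size_sort_card cardfs_gt0.
    by move=> /(proj2 Fs) [i _ /= <-]; rewrite incr_mono.
  by exists (sub 1 0 (L \o N)) => //; apply: incr_sub => //; exact: incr_comp.
exists F, M, x; split=> //.
- exact: incr_increasing_seq.
- split=> [s /xz1[N hN ->]|s1 s2 F1 F2 pl]; first exact: fz.
  have [||N [hN lN e]] := key 0%N [:: s1; s2] isT _ pl.
  - by move=> s; rewrite !inE => /orP[] /eqP ->.
  - have s10 : s1 != fset0 by have [h _ _] := pl; exact: (h 0%N isT).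
    have : [set` s1] (elt s1 0).
      by rewrite /= -(mem_sort leq) /elt mem_nth // size_sort_card cardfs_gt0.
    by move=> /(proj2 F1) [i _ /= <-]; rewrite incr_mono.
  have [_ hb] := hLQ 0%N N hN lN.
  by have := e 0%N isT; have := e 1%N isT; rewrite /= => -> ->.
- exists {poly R}, p, (fun n => 'X^n); split.
  + exact: limit_norm_seminorm hp.
  + exact: poly_hamel_basis.
  + exists (fun l => l.+1%:R^-1); split.
    * by move=> n; rewrite invr_gt0 ltr0n.
    * exact: cvg_harmonic.
    move=> l ss a ssl ssF pl Ml ha.
    have ssl' : (0 < size ss <= l.+2)%N by case/andP: ssl => -> /= /leqW.
    have [N [hN lN e]] := key l ss ssl' ssF pl Ml.
    have /andP[s0 sl] := ssl.
    have sl' : ((size ss).-1 < l.+1)%N by rewrite prednK.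
    have [hu _] := hLQ l N hN lN.
    have := hu (Ordinal sl') a; rewrite /= prednK // => /(_ ha).
    rewrite [comb _ _ _ _](_ : _ = \sum_(j < size ss) a j *: x (nth fset0 ss j)) //.
    by apply: eq_bigr => j _; rewrite e.
  + exact: (limit_norm_l1 zK c0 low hp).
Qed.

(** * Weak limits along the tree of initial segments *)

Lemma closed_cantor_limit (C : set cantor_space) (f : nat -> cantor_space)
    (g : cantor_space) : closed C -> (forall k, C (f k)) ->
  (forall n, exists k0, forall k, (k0 <= k)%N -> f k n = g n) -> C g.
Proof.
move=> cC Cf h; have fg : f @ \oo --> g.
  apply/cvg_sup => i A; rewrite nbhsE => -[B [[V oV VB] Bg] BA].
  have [k0 hk] := h i; exists k0 => // k /= k0k; apply: BA.
  move: Bg; rewrite -!VB /=; rewrite /preimage /= /proj.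
  by rewrite hk.
exact: (@closed_cvg _ _ _ _ _ C cC (nearW _ Cf) _ fg).
Qed.

(** A set in the closure [hat F] but not in [F] has a one-point extension in [hat F], and spreading
    allows any larger new point. A branch never meeting [F] would thus keep all its prefixes in
    [hat F], and compactness would put an infinite set there. *)
Lemma regular_thin_large (F : set {fset nat}) (M : nat -> nat) :
  regular_thin F -> incr M ->
  large [set N : nat -> nat | exists k, F (segment (M \o N) k)].
Proof.
move=> [tF [hF sF cF] [s0 Fs0 s00]] hM.
pose cond t := [/\ sorted ltn t, hat F (fset_of (map M t)) & ~ F (fset_of (map M t))].
have sM t : sorted ltn t -> sorted ltn (map M t).
  by move=> st; apply: (homo_sorted (e := ltn)) st.
exists (fun t => [set n | cond t -> hat F (fset_of (map M (rcons t n)))]) => [t|N hN _ hA].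
  case: (pselect (cond t)) => [[st [f Ff]]|nc]; last by apply: filterS filterT => n _ /nc.
  rewrite /initial_segment sort_fset_of; last exact: sM.
  move=> /prefixP[r hr] nF.
  case: r hr => [|m1 r] hr.
    by case: nF; rewrite -[f]fset_of_sort hr cats0 in Ff *.
  apply: filterS (filterI (free_ultra_gt_seq t) (free_ultra_gt m1)) => n [/= h1 h2] _.
  have s1 : sorted ltn (rcons (map M t) m1).
    by have := sort_leq_sorted f; rewrite hr -cat_rcons => /cat_sorted2[].
  have s2 : sorted ltn (map M (rcons t n)).
    apply: sM; move: st h1; case: (t) => [//|x t'] /= st h1.
    by rewrite rcons_path st /=; apply: h1; rewrite mem_last.
  apply: (sF (fset_of (rcons (map M t) m1))).
  - exists f => //; rewrite /initial_segment sort_fset_of //.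
    by rewrite hr -cat_rcons prefix_prefix.
  - by rewrite !card_fset_of // map_rcons !size_rcons.
  - move=> k; rewrite card_fset_of // size_rcons => hk.
    rewrite !elt_fset_of // map_rcons !nth_rcons.
    move: hk; rewrite ltnS leq_eqVlt => /orP[/eqP ->|-> //].
    rewrite ltnn eqxx; exact: (leq_trans (ltnW h2) (incr_ge hM n)).
apply: contrapT => nF.
have hS := incr_comp hM hN.
have hseg k : hat F (segment (M \o N) k).
  elim: k => [|k IH].
    exists s0 => //; rewrite /initial_segment /segment sort_fset_of //=; exact: prefix0s.
  have := hA k isT; rewrite /= -mkseqS /segment.
  have e j : mkseq (M \o N) j = map M (mkseq N j) by rewrite /mkseq -map_comp.
  rewrite !e; apply; split; first exact: incr_mkseq_sorted.
  - by rewrite -e.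
  - by rewrite -e => h; apply: nF; exists k.
pose g : cantor_space := fun n => `[< range (M \o N) n >].
have [s hs es] : [set ((fun n => n \in s) : cantor_space) | s in hat F] g.
  apply: (closed_cantor_limit (f := fun k => (fun n => n \in segment (M \o N) k) : cantor_space)) => //.
    by move=> k; exists (segment (M \o N) k).
  move=> n; exists n.+1 => k nk; rewrite /g /segment /fset_of in_fset /=.
  apply/idP/asboolP => [/mapP[i _ ->]|[i _ hi]]; first by exists i.
  apply/mapP; exists i => //; rewrite mem_iota /= add0n.
  by apply: (leq_ltn_trans _ nk); rewrite -hi; exact: (incr_ge hS i).
set B := \max_(y <- s) y.
have hB y : y \in s -> (y <= B)%N by move=> ys; rewrite /B (big_rem y ys) /= leq_maxl.
have := congr1 (fun h => h ((M \o N) B.+1)) es.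
rewrite /g; have -> : `[< range (M \o N) ((M \o N) B.+1) >] = true.
  by apply/asboolP; exists B.+1.
by move=> /hB; rewrite leqNgt => /negP; apply; exact: (incr_ge hS).
Qed.

Lemma weak_space_nbhs (R : realType) (X : normedModType R)
    (f : topological_dual X) (x : X) (e : R) : 0 < e ->
  nbhs (x : weak_space X) [set y : X | `|sval f y - sval f x| < e].
Proof.
move=> e0.
have /cvg_sup/(_ f) : nbhs (x : weak_space X) --> (x : weak_space X) by apply: cvg_id.
move=> /(_ [set y : X | `|sval f y - sval f x| < e]); apply.
have := @initial_continuous X R^o (sval f) x _ (nbhsx_ballx (sval f x : R^o) e e0).
rewrite (_ : [set y | _] = sval f @^-1` ball (sval f x : R^o) e) //.
by apply/seteqP; split=> y; rewrite /= -ball_normE /ball_ /= distrC.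
Qed.

#[global] Instance tree_large_filter s : Filter (tree_large s).
Proof.
split.
- exact: tree_largeT.
- by move=> P Q; exact: tree_largeI.
- by move=> P Q PQ; apply: tree_largeS => N _ _; exact: PQ.
Qed.

(** The image of the filter of large sets contains the weakly compact closure, so it has a weak
    cluster point; its neighbourhoods are tested by one functional at a time. *)
Lemma weakly_compact_cluster (R : realType) (X : normedModType R) (K : set X)
    (x : (nat -> nat) -> X) (s : seq nat) : weakly_relatively_compact K ->
  sorted ltn s -> (forall N, incr N -> K (x N)) ->
  exists y : X, forall (f : topological_dual X) (e : R) (Q : set (nat -> nat)),
    0 < e -> tree_large s Q ->
    exists N, [/\ incr N, Q N & `|sval f (x N) - sval f y| < e].
Proof.
move=> cK ss xK.
have PF : ProperFilter (fmap x (tree_large s) : set_system (weak_space X)).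
  apply: Build_ProperFilter_ex => A /(tree_large_ex ss)[N [_ _ h]].
  by exists (x N).
have : (fmap x (tree_large s) : set_system (weak_space X)) (closure (K : set (weak_space X))).
  by apply: tree_largeT => N hN _ /=; apply: subset_closure; exact: xK.
move=> /(cK _ PF)[y [_ cl]]; exists y => f e Q e0 hQ.
have h1 : fmap x (tree_large s) (x @` [set N | incr N /\ Q N]).
  by apply: tree_largeS hQ => N hN _ QN; exists N.
have [_ [[N [hN QN] <-] hy]] := cl _ _ h1 (weak_space_nbhs f y e0).
by exists N.
Qed.

Section TreeLimit.
Variables (R : realType) (X : completeNormedModType R) (b : nat -> X).
Hypothesis sb : schauder_basis b.
Local Notation coord := (schauder_coord b).

Lemma coord_dual i : exists f : topological_dual X, forall x, sval f x = coord x i.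
Proof.
have lin : linear ((fun x => coord x i) : X -> R^o).
  by move=> c x y; rewrite schauder_coord_lin.
pose L := GRing.isLinear.Build _ _ _ _ _ lin.
pose f : {linear X -> R^o} := HB.pack ((fun x => coord x i) : X -> R^o) L.
have [C C0 hC] := schauder_coord_bounded sb i.
have cf : continuous f.
  move=> x; apply/cvgrPdist_le => e e0.
  apply/nbhs_ballP; exists (e / C) => /=; first exact: divr_gt0.
  move=> y; rewrite -ball_normE /ball_ /= => xy.
  rewrite -schauder_coordB //; apply: (le_trans (hC _)).
  by rewrite mulrC -ler_pdivlMr // ltW.
by exists (exist _ f cf).
Qed.

Lemma schauder_coord_inj (x y : X) : (forall i, coord x i = coord y i) -> x = y.
Proof.
move=> h; have hx := @schauder_coordP _ _ _ sb x; have hy := @schauder_coordP _ _ _ sb y.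
have e : (psum b)^~ x = (psum b)^~ y.
  by apply/funext => m; rewrite /psum; apply: eq_bigr => i _; rewrite h.
rewrite e in hx.
exact: (cvg_unique (@norm_hausdorff _ _) hx hy).
Qed.

(** A cluster point suffices: by [tree_large_ultra], closeness of a coordinate holds either largely
    or largely not, and clustering excludes the latter. Locality of [x] thus turns clustering into
    convergence. *)
Lemma tree_limit (K : set X) (x : (nat -> nat) -> X) :
  weakly_relatively_compact K -> local x -> (forall N, incr N -> K (x N)) ->
  exists phi : seq nat -> X, forall s i (e : R), sorted ltn s -> 0 < e ->
    tree_large s [set N | `|coord (x N) i - coord (phi s) i| < e].
Proof.
move=> cK lx xK.
have /choice[phi hphi] : forall s, exists y : X, sorted ltn s ->
    forall (f : topological_dual X) (e : R) (Q : set (nat -> nat)),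
    0 < e -> tree_large s Q ->
    exists N, [/\ incr N, Q N & `|sval f (x N) - sval f y| < e].
  move=> s; case: (boolP (sorted ltn s)) => ss; last by exists 0.
  by have [y hy] := weakly_compact_cluster cK ss xK; exists y.
exists phi => s i e ss e0; have [f hf] := coord_dual i.
have lQ := local_map (fun y : X => `|coord y i - coord (phi s) i| < e : Prop) lx.
have [//|h] := tree_large_ultra ss lQ.
by have [N [hN /= h1]] := hphi s ss f e _ e0 h; rewrite !hf.
Qed.

Variables (x : (nat -> nat) -> X) (phi : seq nat -> X).
Hypothesis hphi : forall s i (e : R), sorted ltn s -> 0 < e ->
    tree_large s [set N | `|coord (x N) i - coord (phi s) i| < e].

Lemma tree_limit_next s i (e : R) : sorted ltn s -> 0 < e ->
  free_ultra [set n | `|coord (phi (rcons s n)) i - coord (phi s) i| < e].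
Proof.
move=> ss e0; have e20 : 0 < e / 2 by rewrite divr_gt0.
apply: filterS (filterI (free_ultra_gt_seq s) (tree_large_next (hphi i ss e20))).
move=> n [/= h1 h2].
have ss' : sorted ltn (rcons s n).
  by case: s ss h1 {h2} => [//|a t'] /= st h1; rewrite rcons_path st /=; apply: h1; rewrite mem_last.
have [N [hN _ [/= h3 h4]]] := tree_large_ex ss' (tree_largeI h2 (hphi i ss' e20)).
move: h3 h4; rewrite !ltr_distl => /andP[? ?] /andP[? ?]; apply/andP; split; lra.
Qed.

(** Beyond the prefix of length [tau N] the map [x] is constant, so the limit at that node is its
    value. *)
Lemma tree_limit_stop tau N : determined tau x -> incr N ->
  phi (mkseq N (tau N)) = x N.
Proof.
move=> dx hN; apply: schauder_coord_inj => i; apply/eqP.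
rewrite eq_sym -subr_eq0 -normr_le0; apply/ler_addgt0Pr => e e0; rewrite add0r.
have ss := incr_mkseq_sorted (tau N) hN.
have [N' [hN' e1 /= h]] := tree_large_ex ss (hphi i ss e0).
rewrite (dx N N') //; first exact: ltW.
rewrite size_mkseq in e1 => j jt; symmetry; exact: mkseq_agreeP e1 jt.
Qed.

Lemma psum_tree_limit_next m s (e : R) : sorted ltn s -> 0 < e ->
  free_ultra [set n | `|psum b m (phi (rcons s n) - phi s)| <= e].
Proof.
move=> ss e0.
have h i : free_ultra [set n | `|coord (phi (rcons s n) - phi s) i| * `|b i| <= e / m.+1%:R].
  have nb : 0 < `|b i| by rewrite normr_gt0 schauder_basis_neq0.
  have e1 : 0 < e / m.+1%:R / `|b i| by rewrite !divr_gt0.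
  apply: filterS (tree_limit_next i ss e1) => n /= h.
  by rewrite schauder_coordB // -ler_pdivlMr // ltW.
apply: filterS (free_ultra_all (iota 0 m) h) => n hn /=.
apply: (le_trans (ler_norm_sum _ _ _)).
apply: (@le_trans _ _ (\sum_(0 <= i < m) e / m.+1%:R)).
  rewrite big_nat [leRHS]big_nat; apply: ler_sum => i /andP[_ im].
  by rewrite normrZ; apply: hn; rewrite mem_iota.
rewrite sumr_const_nat subn0 -[_ *+ m]mulr_natr mulrAC ler_pdivrMr ?ltr0n //.
by rewrite ler_pM2l // ler_nat.
Qed.

End TreeLimit.

Lemma plegma_interlaced (S t : nat -> nat) l : incr S -> (0 < l)%N ->
  (forall j, (j < l)%N -> (0 < t j)%N) ->
  plegma (mkseq (fun j => segment (sub l j S) (t j)) l).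
Proof.
move=> hS l0 ht; have hs j := incr_sub j l0 hS.
split=> [i|i j k|i j k]; rewrite size_mkseq.
- by move=> il; rewrite nth_mkseq // -cardfs_gt0 card_segment ?ht.
- move=> /andP[ij jl]; have il := ltn_trans ij jl.
  rewrite !nth_mkseq // !card_segment // leq_min => /andP[k1 k2].
  by rewrite !elt_segment //; apply: hS; rewrite ltn_add2l.
- move=> il jl; rewrite !nth_mkseq // !card_segment // leq_min ltn_predRL => /andP[k1 k2].
  rewrite !elt_segment //; apply: hS; rewrite mulnS [(l + _)%N]addnC -addnA ltn_add2l.
  exact: ltn_addr.
Qed.

Lemma sum_half_le1 (R : realType) (N : nat -> nat) p : incr N ->
  \sum_(0 <= k < p) (2^-1 : R) ^+ (N k).+1 <= 1.
Proof.
move=> hN; apply: (@le_trans _ _ (\sum_(0 <= k < p) (2^-1 : R) ^+ k.+1)).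
  apply: ler_sum => k _; apply: ler_wiXn2l; rewrite ?ltnS ?incr_ge // ?invr_ge0 //.
  by rewrite invf_le1 // ler1n.
have -> : \sum_(0 <= k < p) (2^-1 : R) ^+ k.+1 = 1 - 2^-1 ^+ p.
  elim: p => [|p IH]; first by rewrite big_nil expr0 subrr.
  rewrite big_nat_recr //= IH exprS; lra.
by rewrite gerBl exprn_ge0 // invr_ge0.
Qed.

(** * Approximation of the increments by blocks *)

Section BlockApproximation.
Variables (R : realType) (X : completeNormedModType R) (b : nat -> X).
Hypothesis sb : schauder_basis b.
Variable phi : seq nat -> X.
Hypothesis psum_next : forall m s (e : R), sorted ltn s -> 0 < e ->
  free_ultra [set n | `|psum b m (phi (rcons s n) - phi s)| <= e].
Local Notation coord := (schauder_coord b).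

Definition increment (s : seq nat) : X := phi s - phi (take (size s).-1 s).

Lemma increment_rcons s n : increment (rcons s n) = phi (rcons s n) - phi s.
Proof. by rewrite /increment size_rcons /= -cats1 take_size_cat. Qed.

Lemma sum_increment (N : nat -> nat) p :
  \sum_(0 <= k < p) increment (mkseq N k.+1) = phi (mkseq N p) - phi [::].
Proof.
rewrite -[RHS](telescope_sumr (fun k => phi (mkseq N k)) (leq0n p)).
by apply: eq_bigr => k _; rewrite mkseqS increment_rcons.
Qed.

Lemma schauder_coord_psum m y j : coord (psum b m y) j = if (j < m)%N then coord y j else 0.
Proof. exact: schauder_coord_finite. Qed.

(* [L] is chosen so sparse that the increment of [phi] at a node ending in
   [L i] is almost supported in the interval [mm i, mm i.+1), which depends
   only on [i]. *)
Lemma block_approximation (eps : R) : 0 < eps ->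
  exists (L mm : nat -> nat) (u : seq nat -> X),
  [/\ incr L, {homo mm : i j / (i <= j)%N},
   forall N k j, incr N -> coord (u (mkseq N k.+1)) j != 0 ->
     (mm (N k) <= j < mm (N k).+1)%N &
   forall N p, incr N ->
     `|phi (mkseq (L \o N) p) - phi [::] - \sum_(0 <= k < p) u (mkseq N k.+1)| <= eps].
Proof.
move=> eps0.
(* Each increment is cut at both ends with error [er i]; two such errors make [eps * 2^-1 ^+ i.+1],
   and these sum to at most [eps]. *)
pose er i : R := eps * 2^-1 ^+ i.+2.
have er0 i : 0 < er i by rewrite mulr_gt0 // exprn_gt0 // invr_gt0.
have /choice[md hmd] : forall ti : seq nat * nat, exists m, forall q, (m <= q)%N ->
    `|increment ti.1 - psum b q (increment ti.1)| <= er ti.2.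
  move=> [t i] /=; have := @schauder_coordP _ _ _ sb (increment t).
  by move=> /cvg_seqP /(_ _ (er0 i)).
(* Sums stand in for maxima: [mfun] dominates the truncation index of every subsequence of [h], and
   summing over the prefixes makes [mm] monotone. *)
pose mfun h := \sum_(t <- subseqs h) md (t, (size h).-1).
pose mmf h := \sum_(i < (size h).+1) mfun (take i h).
pose A h := [set n | forall t, t \in subseqs h ->
  sorted ltn t -> `|psum b (mmf h) (phi (rcons t n) - phi t)| <= er (size h)].
have hA h : free_ultra (A h).
  apply: free_ultra_all => t; case: (boolP (sorted ltn t)) => st.
    by apply: filterS (psum_next (mmf h) st (er0 (size h))).
  by apply: filterS filterT.
have [L [hL _ hLA]] := tree_branch hA (isT : sorted ltn [::]).
pose mm i := mmf (mkseq L i).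
have mmS i : mm i.+1 = (mm i + mfun (mkseq L i.+1))%N.
  rewrite /mm /mmf !size_mkseq [LHS]big_ord_recr take_mkseq_le //; congr (_ + _)%N.
  apply: eq_bigr => j _; have ji : (j <= i)%N by rewrite -ltnS.
  by rewrite !take_mkseq_le // leqW.
have mm_mono : {homo mm : i j / (i <= j)%N}.
  move=> i j /subnKC <-; elim: (j - i)%N => [|n IH]; first by rewrite addn0.
  by rewrite addnS mmS; apply: (leq_trans IH); exact: leq_addr.
(* The last entry of [s] is the index of the last chosen value of [L], so the interval of
   coordinates kept depends on that index alone. *)
pose u s := psum b (mm (last 0%N s).+1) (increment (map L s)) -
  psum b (mm (last 0%N s)) (increment (map L s)).
have eN N k : map L (mkseq N k) = mkseq (L \o N) k by rewrite /mkseq -map_comp.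
have lN N k : last 0%N (mkseq N k.+1) = N k by rewrite mkseqS last_rcons.
exists L, mm, u; split => //.
- move=> N k j hN; rewrite /u lN schauder_coordB // !schauder_coord_psum.
  case: (ltnP j (mm (N k).+1)) => h1; case: (ltnP j (mm (N k))) => h2 //.
  + by rewrite subrr eqxx.
  + by have := leq_trans (mm_mono _ _ (leqnSn (N k))) h1; rewrite leqNgt h2.
  + by rewrite subrr eqxx.
- move=> N p hN; rewrite -sum_increment -sumrB.
  apply: (le_trans (ler_norm_sum _ _ _)).
  apply: (@le_trans _ _ (\sum_(0 <= k < p) eps * 2^-1 ^+ (N k).+1)); last first.
    by rewrite -mulr_sumr -[leRHS]mulr1 ler_pM2l // sum_half_le1.
  apply: ler_sum => k _; rewrite /u lN eN; set d := increment _.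
  have h1 : `|d - psum b (mm (N k).+1) d| <= er (N k).
    apply: (hmd (mkseq (L \o N) k.+1, N k)); rewrite mmS; apply: (leq_trans _ (leq_addl _ _)).
    have hin : mkseq (L \o N) k.+1 \in subseqs (mkseq L (N k).+1).
      apply: mem_subseqs; rewrite !mkseqS -!cats1; apply: cat_subseq => //.
      exact: subseq_mkseq_comp.
    rewrite /mfun size_mkseq (big_rem _ hin); exact: leq_addr.
  have h2 : `|psum b (mm (N k)) d| <= er (N k).
    have := hLA (N k) isT (mkseq (L \o N) k) _ _.
    rewrite size_mkseq /d mkseqS increment_rcons; apply.
      by apply: mem_subseqs; exact: subseq_mkseq_comp.
    exact: incr_mkseq_sorted (incr_comp hL hN).
  rewrite opprB addrA addrAC; apply: (le_trans (ler_normD _ _)).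
  apply: (le_trans (lerD h1 h2)); rewrite /er [in leRHS]exprS exprS exprS; lra.
Qed.

End BlockApproximation.

Theorem theorem0p23 (R : realType) (X : completeNormedModType R)
    (b : nat -> X) :
  schauder_basis b -> property_P b ->
  admits_l1_weakly_relatively_compact X ->
  admits_l1_plegma_block b.
Proof.
move=> sb PP [F [M [x [rF Mincr wrc [E [p [e [sp hb gen l1]]]]]]]].
have [tF _ [s0 Fs0 s00]] := rF.
have [delta [d0 dcvg gen']] := gen.
have [c [Cu [c0 _ hc]]] := l1.
have hM : incr M by move=> i j ij; have := leqW_mono Mincr i j; rewrite ij.
(* The same large set is used at every index; hence each subsequence of [L1] has a prefix giving a
   member of [F], and [tau1] is meaningful on all of them. *)
have [L1 hL1 hF1] := large_diag (fun _ : nat => regular_thin_large rF hM).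
pose H1 := M \o L1; have hH1 : incr H1 := incr_comp hM hL1.
have /choice[tau1 htau1] : forall N, exists k, incr N -> F (segment (H1 \o N) k).
  move=> N; case: (pselect (incr N)) => hN; last by exists 0%N.
  by have [k hk] := hF1 0%N N hN isT; exists k.
have seg_agree N N' k : (forall i, (i < k)%N -> N i = N' i) ->
    segment (H1 \o N) k = segment (H1 \o N') k.
  by move=> ag; congr fset_of; apply: mkseq_agree => i ik /=; rewrite ag.
have dtau1 : determined tau1 tau1.
  move=> N N' hN hN' ag; apply: (thin_segment tF (incr_comp hH1 hN')).
    by rewrite -(seg_agree N N') //; exact: htau1.
  exact: htau1.
pose x1 N := x (segment (H1 \o N) (tau1 N)).
have dx1 : determined tau1 x1.
  by move=> N N' hN hN' ag; rewrite /x1 (seg_agree N N') // (dtau1 N N').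
have inF N : incr N -> restrict_family F M (segment (H1 \o N) (tau1 N)).
  move=> hN; split; first exact: htau1.
  move=> n /=; rewrite /segment /fset_of in_fset /= => /mapP[i _ ->].
  by exists (L1 (N i)).
have K1 N : incr N -> (x @` restrict_family F M) (x1 N).
  by move=> hN; exists (segment (H1 \o N) (tau1 N)); first exact: inF.
have [phi hphi] := tree_limit sb wrc (determined_local dx1) K1.
(* The constant falls from [c] to [c / 2] by the error in [generates], then to [c / 4] on removal of
   [phi [::]]; an approximation within [c / 16] keeps it positive. *)
have c80 : 0 < c / 16 by rewrite divr_gt0.
have [L2 [mm [u [hL2 mmono usupp uapp]]]] :=
  block_approximation sb (psum_tree_limit_next sb hphi) c80.
pose tau N := tau1 (L2 \o N); pose H := H1 \o L2; pose x2 N := x1 (L2 \o N).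
have hH : incr H := incr_comp hH1 hL2.
have dtau : determined tau tau.
  move=> N N' hN hN' ag; apply: dtau1; [exact: incr_comp|exact: incr_comp|].
  by move=> i it /=; rewrite ag.
have dx2 : determined tau x2.
  move=> N N' hN hN' ag; apply: dx1; [exact: incr_comp|exact: incr_comp|].
  by move=> i it /=; rewrite ag.
have taupos N : incr N -> (0 < tau N)%N.
  move=> hN; have hN' := incr_comp hL2 hN.
  have := thin_neq0 tF Fs0 s00 (htau1 _ hN').
  by rewrite -cardfs_gt0 card_segment //; exact: incr_comp.
pose w := partial_sum u tau.
have xw N : incr N -> `|x2 N - phi [::] - w N| <= c / 16.
  move=> hN; rewrite /x2 -(tree_limit_stop sb hphi dx1 (incr_comp hL2 hN)).
  exact: uapp.
(* Dividing by [S] brings the coefficients into [[-1, 1]] and their l^1 norm to 1; on sequences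
   starting beyond [n] the error [delta n] is at most [c / 2]. *)
have lowx2 : lower x2 (c / 2).
  move=> l a l0; set S := \sum_(j < l) `|a j|.
  have [S0|S0] := eqVneq S 0.
    by apply: tree_largeT => N _ _ /=; rewrite S0 mulr0.
  have Sp : 0 < S by rewrite lt_neqAle eq_sym S0 sumr_ge0.
  have c20 : 0 < c / 2 by rewrite divr_gt0.
  have /cvg_seqP /(_ _ c20)[n0 hn0] := dcvg.
  pose n := maxn n0 l.
  apply: tree_largeS (large_ge n) => N hN _ /= nN.
  pose ss := mkseq (fun j => segment (sub l j (H \o N)) (tau (sub l j N))) l.
  have pl : plegma ss.
    apply: plegma_interlaced => //; first exact: incr_comp.
    by move=> j jl; apply: taupos; exact: incr_sub.
  pose a' j := S^-1 * a j.
  have h1 : (0 < size ss <= n.+1)%N by rewrite size_mkseq l0 leqW // leq_maxr.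
  have h2 s : s \in ss -> restrict_family F M s.
    move=> /mapP[j]; rewrite mem_iota add0n => /= jl ->.
    exact: (inF _ (incr_comp hL2 (incr_sub j l0 hN))).
  have h3 : (M n <= elt (nth fset0 ss 0) 0)%N.
    rewrite nth_mkseq // elt_segment; [|apply: incr_sub => //; exact: incr_comp|].
      rewrite /sub muln0 addn0 /H /H1 /= incr_mono //.
      by apply: (leq_trans nN); apply: (leq_trans (incr_ge hL2 _)); exact: incr_ge.
    by apply: taupos; exact: incr_sub.
  have h4 j : (j < size ss)%N -> -1 <= a' j <= 1.
    rewrite size_mkseq => jl; rewrite -ler_norml normrM gtr0_norm ?invr_gt0 //.
    rewrite mulrC ler_pdivrMr // mul1r /S (bigD1 (Ordinal jl)) //= lerDl.
    exact: sumr_ge0.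
  have := gen' n ss a' h1 h2 pl h3 h4.
  have dn : delta n <= c / 2.
    have := hn0 n (leq_maxl _ _); rewrite sub0r normrN; apply: le_trans.
    exact: ler_norm.
  have e1 : \sum_(j < size ss) a' j *: x (nth fset0 ss j) = S^-1 *: comb x2 a l N.
    rewrite size_mkseq /comb scaler_sumr; apply: eq_bigr => j _.
    by rewrite nth_mkseq // scalerA.
  have [h5 _] := hc (size ss) a'.
  have e2 : \sum_(j < size ss) `|a' j| = 1.
    rewrite size_mkseq; under eq_bigr => j _ do rewrite normrM gtr0_norm ?invr_gt0 //.
    by rewrite -mulr_sumr mulVf.
  rewrite e2 mulr1 in h5.
  rewrite e1 normrZ gtr0_norm ?invr_gt0 // ler_distl => /andP[h6 _].
  have h7 : c / 2 <= S^-1 * `|comb x2 a l N| by lra.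
  by rewrite -ler_pdivlMr // [leRHS]mulrC.
have lowr : lower (fun N => x2 N - phi [::]) (c / 2 / 2).
  have c20 : 0 < c / 2 by rewrite divr_gt0.
  have lx2 := determined_local dx2.
  have ls : lower (fun N => phi [::] + (x2 N - phi [::])) (c / 2).
    by rewrite (_ : (fun N => _) = x2) //; apply/funext => N; rewrite addrCA subrr addr0.
  have lr := local_map (fun y => y - phi [::]) lx2.
  (* A constant map admits no lower l^1 estimate, as the coefficients [1, -1] show, so only the
     second alternative survives. *)
  have [[c' c'0 hc']|//] := lower_split c20 (local_cst (phi [::])) lr ls.
  pose a j : R := if j == 0%N then 1 else -1.
  have [N [hN _ /=]] := tree_large_ex (isT : sorted ltn [::]) (hc' 2%N a isT).
  rewrite /comb !big_ord_recr !big_ord0 /a /= !add0r scale1r scaleN1r subrr normr0.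
  by rewrite normrN normr1 => h; exfalso; lra.
have loww : lower w (c / 2 / 2 - c / 16) by apply: lower_perturb lowr.
pose B := p (\sum_(j < 1) 1 *: e j) + delta 0%N.
have xB N : incr N -> `|x2 N| <= B.
  move=> hN; have hN' := incr_comp hL2 hN.
  have pl : plegma [:: segment (H1 \o (L2 \o N)) (tau1 (L2 \o N))].
    rewrite (_ : [:: _] = mkseq (fun j => segment (sub 1 j (H1 \o (L2 \o N))) (tau N)) 1).
      by apply: plegma_interlaced => // [|_ _]; [exact: incr_comp|exact: taupos].
    by rewrite /mkseq [map _ _]/= sub10.
  set s := segment _ _ in pl.
  have h1 t : t \in [:: s] -> restrict_family F M t by rewrite inE => /eqP ->; exact: inF.
  have h2 : (M 0 <= elt (nth fset0 [:: s] 0) 0)%N.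
    by rewrite elt_segment; [rewrite incr_mono|exact: incr_comp|exact: taupos].
  pose a1 : nat -> R := fun=> 1.
  have h3 j : (j < size [:: s])%N -> -1 <= a1 j <= 1 by rewrite /a1 => _; lra.
  have := gen' 0%N [:: s] a1 isT h1 pl h2 h3.
  by rewrite /B /= !big_ord1 /a1 /= !scale1r ler_distl => /andP[_].
pose K := `|B| + `|phi [::]| + c / 16.
have K0 : 0 < K by rewrite ltr_wpDl // addr_ge0.
have wK N : incr N -> `|block u N 0 (tau N)| <= K.
  move=> hN; have -> : block u N 0 (tau N) = x2 N - phi [::] - (x2 N - phi [::] - w N).
    by rewrite opprB addrA addrAC subrr add0r.
  apply: (le_trans (ler_normB _ _)); apply: lerD; last exact: xw.
  apply: (le_trans (ler_normB _ _)); rewrite lerD2r.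
  exact: (le_trans (xB N hN) (ler_norm _)).
have usupp' N k : incr N -> (k < tau N)%N -> forall j,
    schauder_coord b (u (mkseq N k.+1)) j != 0 -> (mm (N k) <= j < mm (N k).+1)%N.
  by move=> hN _ j; exact: usupp.
have cw0 : 0 < c / 2 / 2 - c / 16 by lra.
have [al [be [sal sbe ab sep [c' c'0 lowz]]]] :=
  l1_block_exists sb mmono usupp' dtau K0 wK PP cw0 loww.
have [C C0 hC] := block0_bounded sb mmono usupp' K0 wK.
have [dal lal] := sal; have [dbe lbe] := sbe.
apply: (@admits_l1_plegma_block_of_lower _ _ b F H tau
  (fun N => block u N (al N) (be N)) (C + C) c' rF hH) => //.
- by move=> N hN; exact: (htau1 _ (incr_comp hL2 hN)).
- exact: determined_block sal sbe.
- move=> N hN; have -> : block u N (al N) (be N) = block u N 0 (be N) - block u N 0 (al N).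
    by rewrite (@block_cat _ _ _ _ 0 (al N)) ?ab // addrC addKr.
  by apply: (le_trans (ler_normB _ _)); apply: lerD; apply: hC; rewrite ?lal ?lbe.
- move=> N hN; apply: (@sub_finite_set _ _ `I_(mm (N (be N)))); last exact: finite_II.
  by move=> j /(block_supp sb mmono usupp' hN (lbe _ hN)) /andP[].
- apply: tree_largeS sep => N hN _ /= h m n.
  have hS0 : incr (sub 2 0 N) by exact: incr_sub.
  have hS1 : incr (sub 2 1 N) by exact: incr_sub.
  move=> /(block_coord sb usupp' hS0 (lbe _ hS0)) [k /andP[_ k2] /andP[_ k4]].
  move=> /(block_coord sb usupp' hS1 (lbe _ hS1)) [k' /andP[k1' _] /andP[k3' _]].
  apply: (leq_trans k4); apply: (leq_trans _ k3'); apply: mmono.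
  (* From [k < beta] for the first member and [beta <= alpha + 1], with [alpha] taken at the second
     member, [k <= alpha <= k']. *)
  have kk : (k <= k')%N.
    by rewrite -ltnS; apply: (leq_trans k2); apply: (leq_trans h); rewrite ltnS.
  apply: hN; lia.
Qed.
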